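(* For every $\varepsilon>0$ and $r>\varepsilon$, $$S_r(\varepsilon)\ \ge\ \frac{2\varepsilon}{r^2M_{2,n}}.$$
   Context: For a compact family $\mathcal{A}$ of real $n\times n$ matrices: the switching system is $\dot{\boldsymbol{x}}=A(t)\boldsymbol{x}$ with $A(\cdot)$ any measurable function $\mathbb{R}_+\to\mathcal{A}$; $\sigma(\mathcal{A})$ is the infimum of $\alpha$ such that for some $C$ all trajectories satisfy $\|\boldsymbol{x}(t)\|\le Ce^{\alpha t}\|\boldsymbol{x}(0)\|$; the joint spectral radius of a compact set $\mathcal{B}$ is $\rho(\mathcal{B})=\lim_k\max_{B(j)\in\mathcal{B}}\|B(k)\cdots B(1)\|^{1/k}$; $S_{\mathcal{A}}(\varepsilon)=+\infty$ if $\sigma(\mathcal{A})\ge-\varepsilon$ and $S_{\mathcal{A}}(\varepsilon)=\sup\{\tau>0:\rho(I+\tau\mathcal{A})<1\}$ otherwise. $S_r(\varepsilon)=\inf\{S_{\mathcal{A}}(\varepsilon): \max_{A\in\mathcal{A}}\rho(A)\le r\}$, the infimum over compact families of $n\times n$ matrices, $\rho(A)$ being the spectral radius. For $\boldsymbol{h}\in\mathbb{C}^n$ with $\mathrm{Re}\,h_k>0$, $\mathcal{P}_{\boldsymbol{h}}$ is the space of complex linear combinations on $[0,\infty)$ of $e^{-h_kt}$ (a value of multiplicity $r$ contributing $e^{-ht},\dots,t^{r-1}e^{-ht}$), $M_2(\boldsymbol{h})=\max\{\|p''\|_\infty:p\in\mathcal{P}_{\boldsymbol{h}},\|p\|_\infty\le1\}$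 with $\|f\|_\infty=\sup_{t\ge0}|f(t)|$, and $M_{2,n}=\max_{\boldsymbol{h}\in\mathcal{D}_n}M_2(\boldsymbol{h})$, where $\mathcal{D}_n=\{\boldsymbol{z}\in\mathbb{C}^n:|z_k|\le1,\ \mathrm{Re}\,z_k>0\}$. *)

(* Defs.v *)
From HB Require Import structures.
From mathcomp Require Import all_boot all_order all_algebra.
From mathcomp Require Import all_classical all_reals all_analysis.
From mathcomp Require Import complex.
Export Order.TTheory GRing.Theory Num.Theory.
Export numFieldNormedType.Exports.

Set Implicit Arguments.
Unset Strict Implicit.
Unset Printing Implicit Defensive.

Local Open Scope classical_set_scope.
Local Open Scope ring_scope.

(* [switching_traj fam A x] : A is a measurable switching signal with
   values in fam on R_+, and x is a (Caratheodory) solution of x' = A(t)x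
   on R_+, i.e. x is continuous and x(t) = x(0) + \int_0^t A(s)x(s) ds. *)
Definition switching_traj (R : realType) (n : nat) (fam : set 'M[R]_n)
    (A : R -> 'M[R]_n) (x : R -> 'cV[R]_n) : Prop :=
  [/\ (forall t, 0 <= t -> fam (A t)),
      (forall i j, measurable_fun [set: R] (fun t : R => A t i j)),
      {within `[0%R, +oo[, continuous x} &
      (forall t, 0 <= t -> forall i,
        ((x t i ord0 - x 0 i ord0)%:E =
          \int[lebesgue_measure]_(s in `[0%R, t]) ((A s *m x s) i ord0)%:E)%E)].

Definition growth_rate (R : realType) (n : nat) (fam : set 'M[R]_n) (a : R) :=
  exists C : R, forall A x, switching_traj fam A x ->
    forall t, 0 <= t -> `|x t| <= C * expR (a * t) * `|x 0|.

Definition sigma_sw (R : realType) (n : nat) (fam : set 'M[R]_n) : \bar R :=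
  ereal_inf [set a%:E | a in growth_rate fam].

Definition jsr (R : realType) (n : nat) (B : set 'M[R]_n) : R :=
  limn (fun k : nat =>
    sup [set `|foldr (@mulmx R n n n) 1%:M s| `^ (k.+1%:R)^-1
        | s in [set s : seq 'M[R]_n | size s = k.+1 /\ forall M, M \in s -> B M]]).

Definition S_fam (R : realType) (n : nat) (fam : set 'M[R]_n) (eps : R) : \bar R :=
  if ((- eps)%:E <= sigma_sw fam)%E then +oo%E
  else ereal_sup [set tau%:E | tau in
         [set tau : R | 0 < tau /\ jsr [set 1%:M + tau *: M | M in fam] < 1]].

Definition specrad (R : realType) (n : nat) (A : 'M[R]_n) : R :=
  sup [set ComplexField.Normc.normc z | z in
        [set z : R[i] | root (char_poly (map_mx (fun a : R => (a%:C)%C : R[i]) A)) z]].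

Definition S_r (R : realType) (n : nat) (eps r : R) : \bar R :=
  ereal_inf [set S_fam fam eps | fam in
    [set fam : set 'M[R]_n | [/\ compact fam, fam !=set0 &
                                 forall A, fam A -> specrad A <= r]]].

Definition cexp (R : realType) (z : R[i]) : R[i] :=
  ((expR (complex.Re z))%:C * ((cos (complex.Im z))%:C + 'i * (sin (complex.Im z))%:C))%C.

Definition mult_before (R : realType) (n : nat) (h : 'I_n -> R[i]) (k : 'I_n) : nat :=
  #|[set j : 'I_n | (j < k)%N && (h j == h k)]|.

(* The element of P_h with coefficients c: the k-th basis function is
   t^(m_k) e^{-h_k t}, where m_k = number of j < k with h_j = h_k; this
   lists, for each value h of multiplicity r, e^{-ht}, ..., t^{r-1}e^{-ht}. *)
Definition Ph (R : realType) (n : nat) (h c : 'I_n -> R[i]) : R -> R[i] :=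
  fun t => \sum_(k < n) c k * (t%:C)%C ^+ (mult_before h k) * cexp (- h k * (t%:C)%C).

Definition supn (R : realType) (f : R -> R[i]) : \bar R :=
  ereal_sup [set (ComplexField.Normc.normc (f t))%:E | t in `[0%R, +oo[].

Definition deriv2C (R : realType) (f : R -> R[i]) : R -> R[i] :=
  fun t => Complex (derive1 (derive1 (fun s => complex.Re (f s))) t)
                   (derive1 (derive1 (fun s => complex.Im (f s))) t).

Definition M2 (R : realType) (n : nat) (h : 'I_n -> R[i]) : \bar R :=
  ereal_sup [set supn (deriv2C (Ph h c)) | c in
              [set c : 'I_n -> R[i] | (supn (Ph h c) <= 1)%E]].

Definition Dn (R : realType) (n : nat) : set ('I_n -> R[i]) :=
  [set h | forall k, ComplexField.Normc.normc (h k) <= 1 /\ 0 < complex.Re (h k)].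

Definition M2n (R : realType) (n : nat) : \bar R :=
  ereal_sup [set M2 h | h in @Dn R n].

(* Main.v *)
Require Import Defs.
From HB Require Import structures.
From mathcomp Require Import all_boot all_order all_algebra.
From mathcomp Require Import all_classical all_reals all_analysis.
From mathcomp Require Import complex.
From mathcomp Require Import measurable_realfun.
From mathcomp Require Import ring lra.
Import Order.TTheory GRing.Theory Num.Theory.
Import numFieldNormedType.Exports.
Local Open Scope ring_scope.

(* Let sigma(A) < - eps and let N(x) be the supremum of e^{eps T} |x(T)| over
   the trajectories of piecewise constant switching signals starting at x: this
   is a norm with N(e^{t(A + eps)} x) <= N(x) for every A in the family. Every
   coordinate q(u) of a discounted orbit of u |-> e^{u(A + eps)/rho} x, where
   rho^2 = r^2 - eps^2, is bounded by N(x). The eigenvalues mu of A have |mu| <= r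
   and Re mu < - eps, so |mu + eps| <= rho and q lies in a space P_h with h in
   D_n; hence |q''| <= M_{2,n} N(x). Taylor's formula at 0 then bounds
   (I + tau A) x = (1 - eps tau) (q(0) + u q'(0)), u = rho tau / (1 - eps tau), and
   N((I + tau A) x) <= lam N(x) with
   lam = 1 - eps tau + rho^2 tau^2 M_{2,n} / (2 (1 - eps tau)).
   Since M_{2,n} >= 2 for n >= 2, lam < 1 as soon as tau < 2 eps / (r^2 M_{2,n}).
   For n = 1, where only M_{2,1} >= 1 is available, the scalars 1 + tau a
   are estimated directly; if M_{2,n} were infinite it would suffice that some
   tau > 0 is admissible, which follows from a crude bound on q''. *)

Set Implicit Arguments.
Unset Strict Implicit.
Unset Printing Implicit Defensive.

Local Notation Re := complex.Re.
Local Notation Im := complex.Im.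
Local Notation normc := ComplexField.Normc.normc.

Lemma scale_regularE (R : realType) (a b : R) : a *: (b : R^o) = a * b.
Proof. by []. Qed.

(** * Complex-valued exponential polynomials of a real variable *)

Section ComplexCalculus.
Variable R : realType.
Implicit Types (f g : R -> R[i]) (z mu nu c : R[i]) (t : R).

Lemma complex_ReD z c : Re (z + c) = Re z + Re c. Proof. by case: z; case: c. Qed.
Lemma complex_ImD z c : Im (z + c) = Im z + Im c. Proof. by case: z; case: c. Qed.
Lemma complex_ReM z c : Re (z * c) = Re z * Re c - Im z * Im c.
Proof. by case: z; case: c. Qed.
Lemma complex_ImM z c : Im (z * c) = Re z * Im c + Im z * Re c.
Proof. by case: z; case: c. Qed.

(** Differentiating the real and imaginary parts separately matches [deriv2C] and lets the real
    product and chain rules do the work. *)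
Definition is_cderive f f' := forall t : R,
  is_derive t (1 : R) (fun s => Re (f s)) (Re (f' t)) /\
  is_derive t (1 : R) (fun s => Im (f s)) (Im (f' t)).

Lemma is_cderive_eq f g f' g' : is_cderive f f' -> f =1 g -> f' =1 g' ->
  is_cderive g g'.
Proof. by move=> H /funext <- /funext <-. Qed.

Lemma is_cderive_cst c : is_cderive (fun=> c) (fun=> 0).
Proof. by move=> t; split; apply: is_derive_cst. Qed.

Lemma is_cderiveD f g f' g' : is_cderive f f' -> is_cderive g g' ->
  is_cderive (fun t => f t + g t) (fun t => f' t + g' t).
Proof.
move=> Hf Hg t; have [f1 f2] := Hf t; have [g1 g2] := Hg t; split.
  under eq_fun do rewrite complex_ReD.
  by rewrite complex_ReD; apply: is_deriveD.
under eq_fun do rewrite complex_ImD.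
by rewrite complex_ImD; apply: is_deriveD.
Qed.

Lemma is_cderiveM f g f' g' : is_cderive f f' -> is_cderive g g' ->
  is_cderive (fun t => f t * g t) (fun t => f' t * g t + f t * g' t).
Proof.
move=> Hf Hg t; have [f1 f2] := Hf t; have [g1 g2] := Hg t; split.
  under eq_fun do rewrite complex_ReM.
  apply: (is_derive_eq (is_deriveB (is_deriveM f1 g1) (is_deriveM f2 g2))).
  by rewrite complex_ReD !complex_ReM !scale_regularE; ring.
under eq_fun do rewrite complex_ImM.
apply: (is_derive_eq (is_deriveD (is_deriveM f1 g2) (is_deriveM f2 g1))).
by rewrite complex_ImD !complex_ImM !scale_regularE; ring.
Qed.

Lemma is_cderiveZ c f f' : is_cderive f f' ->
  is_cderive (fun t => c * f t) (fun t => c * f' t).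
Proof.
move=> Hf; apply: (is_cderive_eq (is_cderiveM (is_cderive_cst c) Hf)) => // t.
by rewrite mul0r add0r.
Qed.

Lemma is_cderive_real : is_cderive (fun t => t%:C%C) (fun=> 1).
Proof. by move=> t; split => /=; [exact: is_derive_id|exact: is_derive_cst]. Qed.

Lemma is_cderiveX m :
  is_cderive (fun t => t%:C%C ^+ m) (fun t => m%:R * t%:C%C ^+ m.-1).
Proof.
elim: m => [|m IH].
  apply: (is_cderive_eq (is_cderive_cst 1)) => t; first by rewrite expr0.
  by rewrite mul0r.
apply: (is_cderive_eq (is_cderiveM is_cderive_real IH)) => t.
  by rewrite exprS.
rewrite mul1r mulrCA [m.+1.-1]/= -[m.+1]add1n natrD mulrDl mul1r; congr (_ + _).
by case: m {IH} => [|m]; rewrite ?mul0r // -exprS.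
Qed.

Lemma cexpE mu t : cexp (mu * t%:C%C) =
  Complex (expR (Re mu * t) * cos (Im mu * t)) (expR (Re mu * t) * sin (Im mu * t)).
Proof.
rewrite /cexp complex_ReM complex_ImM /= !mulr0 subr0 add0r.
by congr Complex; rewrite !(mul0r, mulr0, add0r, addr0, subr0, mul1r, oppr0).
Qed.

Lemma is_derive_comp_lin (f : R -> R) a t df : is_derive (a * t) 1 f df ->
  is_derive t (1 : R) (fun s => f (a * s)) (a * df).
Proof.
move=> Hf.
have Ha : is_derive t (1 : R) (fun s => a * s) a.
  have -> : (fun s : R => a * s) = a \*: (@id R) by apply/funext.
  by apply: is_derive_eq; rewrite [LHS]mulr1.
by have := is_derive1_comp Hf Ha; rewrite mulrC.
Qed.

Lemma is_cderive_cexp mu :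
  is_cderive (fun t => cexp (mu * t%:C%C)) (fun t => mu * cexp (mu * t%:C%C)).
Proof.
move=> t; rewrite cexpE.
have E := is_derive_comp_lin (is_derive_expR (Re mu * t)).
have Cs := is_derive_comp_lin (is_derive_cos (Im mu * t)).
have Sn := is_derive_comp_lin (is_derive_sin (Im mu * t)).
split; under eq_fun do rewrite cexpE.
  by apply: (is_derive_eq (is_deriveM E Cs)); rewrite complex_ReM /= !scale_regularE; ring.
by apply: (is_derive_eq (is_deriveM E Sn)); rewrite complex_ImM /= !scale_regularE; ring.
Qed.

Definition expmono m mu t : R[i] := t%:C%C ^+ m * cexp (mu * t%:C%C).

Lemma is_cderive_expmono m mu : is_cderive (expmono m mu)
  (fun t => mu * expmono m mu t + m%:R * expmono m.-1 mu t).
Proof.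
apply: (is_cderive_eq (is_cderiveM (is_cderiveX m) (is_cderive_cexp mu))) => //.
by move=> t; rewrite /expmono; ring.
Qed.

(** This is the space P_h with h = - s, described by multiplicities alone: unlike [Ph], it does not
    depend on the order of the exponents, which makes closure properties easy. [exppoly_Ph] converts
    back. *)
Inductive exppoly (s : seq R[i]) : (R -> R[i]) -> Prop :=
| exppoly_nil : exppoly s (fun=> 0)
| exppoly_cons c m mu f : (m < count_mem mu s)%N -> exppoly s f ->
    exppoly s (fun t => c * expmono m mu t + f t).

Lemma exppoly_ext s f g : exppoly s f -> f =1 g -> exppoly s g.
Proof. by move=> H /funext <-. Qed.

Lemma exppoly_sub s s' f : (forall mu, (count_mem mu s <= count_mem mu s')%N) ->
  exppoly s f -> exppoly s' f.
Proof.
move=> ss'; elim => [|c m mu {}f Hm _ IH]; first exact: exppoly_nil.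
by apply: exppoly_cons IH; apply: leq_trans (ss' mu).
Qed.

Lemma exppolyD s f g : exppoly s f -> exppoly s g -> exppoly s (fun t => f t + g t).
Proof.
move=> + Hg; elim => [|c m mu {}f Hm _ IH].
  by apply: exppoly_ext Hg _ => t; rewrite add0r.
by apply: (exppoly_ext (exppoly_cons c Hm IH)) => t; rewrite addrA.
Qed.

Lemma exppolyZ s c f : exppoly s f -> exppoly s (fun t => c * f t).
Proof.
elim => [|d m mu {}f Hm _ IH].
  by apply: exppoly_ext (exppoly_nil _) _ => t; rewrite mulr0.
by apply: (exppoly_ext (exppoly_cons (c * d) Hm IH)) => t; rewrite mulrDr mulrA.
Qed.

Lemma exppoly_sum s (I : Type) (r : seq I) (c : I -> R[i]) (f : I -> R -> R[i]) :
  (forall i, exppoly s (f i)) -> exppoly s (fun t => \sum_(i <- r) c i * f i t).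
Proof.
move=> Hf; elim: r => [|i r IH].
  by apply: exppoly_ext (exppoly_nil _) _ => t; rewrite big_nil.
by apply: (exppoly_ext (exppolyD (exppolyZ (c i) (Hf i)) IH)) => t; rewrite big_cons.
Qed.

Lemma exppoly_mono s m mu : (m < count_mem mu s)%N -> exppoly s (expmono m mu).
Proof.
move=> Hm; apply: (exppoly_ext (exppoly_cons 1 Hm (exppoly_nil _))) => t.
by rewrite mul1r addr0.
Qed.

(** Resonance mu = nu raises the degree by one, which the extra copy of mu pays for. Without
    resonance, integration by parts lowers the degree, so induction on m applies. *)
Lemma exppoly_ode_mono m mu nu : exists2 g, exppoly (mu :: nseq m.+1 nu) g &
  is_cderive g (fun t => mu * g t + expmono m nu t).
Proof.
have [<-|neq] := eqVneq mu nu.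
  exists (fun t => (m.+1%:R)^-1 * expmono m.+1 mu t).
    by apply/exppolyZ/exppoly_mono; rewrite /= eqxx count_nseq /= eqxx mul1n.
  apply: (is_cderive_eq (is_cderiveZ _ (is_cderive_expmono _ _))) => // t /=.
  by rewrite mulrDr mulrCA; congr (_ + _); rewrite mulrA mulVf ?mul1r ?pnatr_eq0.
have neq' : nu - mu != 0 by rewrite subr_eq0 eq_sym.
elim: m => [|m [g Hg dg]].
  exists (fun t => (nu - mu)^-1 * expmono 0 nu t).
    by apply/exppolyZ/exppoly_mono; rewrite /= eqxx (negbTE neq).
  apply: (is_cderive_eq (is_cderiveZ _ (is_cderive_expmono _ _))) => // t /=.
  by rewrite mul0r addr0; field.
exists (fun t => (nu - mu)^-1 * (expmono m.+1 nu t + (- m.+1%:R) * g t)).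
  apply/exppolyZ/exppolyD.
    by apply/exppoly_mono; rewrite /= count_nseq /= eqxx mul1n (negbTE neq).
  apply/exppolyZ/(exppoly_sub _ Hg) => x; rewrite /= leq_add2l.
  by rewrite leq_addl.
apply: (is_cderive_eq (is_cderiveZ _ (is_cderiveD (is_cderive_expmono _ _)
  (is_cderiveZ _ dg)))) => // t /=.
by field.
Qed.

(** Particular solutions for the single terms of f are superposed; a multiple of the homogeneous
    solution e^{mu t} then corrects the initial value. *)
Lemma exppoly_ode s f mu c : exppoly s f ->
  exists g, [/\ exppoly (mu :: s) g, g 0 = c &
                is_cderive g (fun t => mu * g t + f t)].
Proof.
move=> Hf.
suff [g Hg dg] : exists2 g, exppoly (mu :: s) g &
    is_cderive g (fun t => mu * g t + f t).
  exists (fun t => g t + (c - g 0) * expmono 0 mu t); split.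
  - apply: exppolyD => //; apply/exppolyZ/exppoly_mono.
    by rewrite /= eqxx.
  - have -> : expmono 0 mu 0 = 1.
      rewrite /expmono cexpE expr0 !mulr0 expR0 cos0 sin0 mul1r.
      by congr Complex; rewrite ?mul1r ?mulr0.
    by rewrite mulr1 addrC subrK.
  - apply: (is_cderive_eq (is_cderiveD dg (is_cderiveZ _
      (is_cderive_expmono _ _)))) => // t /=.
    by rewrite mul0r; ring.
elim: Hf => [|{}c m nu {}f Hm _ [g Hg dg]].
  exists (fun=> 0); first exact: exppoly_nil.
  by apply: (is_cderive_eq (is_cderive_cst 0)) => // t; rewrite mulr0 addr0.
have [g1 Hg1 dg1] := exppoly_ode_mono m mu nu.
exists (fun t => c * g1 t + g t).
  apply: exppolyD Hg; apply/exppolyZ/(exppoly_sub _ Hg1) => x.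
  rewrite -[_ :: nseq _ _]cat1s -[_ :: s]cat1s !count_cat leq_add2l count_nseq /=.
  case: eqP => [<-|_]; last by rewrite mul0n.
  by rewrite mul1n.
apply: (is_cderive_eq (is_cderiveD (is_cderiveZ _ dg1) dg)) => // t /=.
by ring.
Qed.

Lemma conjc_cexp mu t : conjc (cexp (mu * t%:C%C)) = cexp (conjc mu * t%:C%C).
Proof.
by rewrite !cexpE; case: mu => a b /=; rewrite mulNr cosN sinN mulrN.
Qed.

Lemma exppoly_conjc s f : exppoly s f ->
  exppoly (map conjc s) (fun t => conjc (f t)).
Proof.
elim => [|c m mu {}f Hm _ IH].
  by apply: exppoly_ext (exppoly_nil _) _ => t; rewrite conjc0.
have Hm' : (m < count_mem (conjc mu) (map conjc s))%N.
  rewrite count_map (eq_count (a2 := pred1 mu)) // => x /=.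
  by rewrite (inj_eq (can_inj (@conjcK R))).
apply: (exppoly_ext (exppoly_cons (conjc c) Hm' IH)) => t.
rewrite /expmono -conjc_cexp -{1}(conjc_real t).
by rewrite -(rmorphXn (@conjc R)) -!(rmorphM (@conjc R)) -(rmorphD (@conjc R)).
Qed.

(** A running count grows by steps of at most one, so it takes the value m just before some index
    satisfying P. *)
Lemma sum_bool_jump (P : nat -> bool) n m : (m < \sum_(0 <= j < n) P j)%N ->
  exists k, [/\ (k < n)%N, P k & (\sum_(0 <= j < k) P j)%N = m].
Proof.
elim: n => [|n IH]; first by rewrite big_nil.
rewrite big_nat_recr //=; have [lt _|le] := ltnP m (\sum_(0 <= j < n) P j)%N.
  by have [k [kn Pk Hk]] := IH lt; exists k; split=> //; apply: ltnW.
case Pn : (P n); last by rewrite addn0 ltnNge le.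
rewrite addn1 ltnS => le2; exists n; split => //.
by apply/eqP; rewrite eqn_leq le2 le.
Qed.

Lemma PhD n (h c d : 'I_n -> R[i]) t :
  Ph h (fun k => c k + d k) t = Ph h c t + Ph h d t.
Proof. by rewrite /Ph -big_split; apply: eq_bigr => i _ /=; ring. Qed.

Lemma exppoly_Ph n (s : seq R[i]) f : size s = n -> exppoly s f ->
  exists c : 'I_n -> R[i], f = Ph (fun k : 'I_n => - s`_k) c.
Proof.
move=> szs; set h := (fun k : 'I_n => _).
elim => [|c m mu {}f Hm _ [d ->]].
  exists (fun=> 0); apply/funext => t; rewrite /Ph big1 // => i _.
  by rewrite !mul0r.
(* The term t^m e^{mu t} is placed at the occurrence of mu in s preceded by exactly m others, where
   [mult_before] equals m. *)
have [|k [kn /eqP sk Hk]] := @sum_bool_jump (fun j => s`_j == mu) n m.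
  rewrite (leq_trans Hm) // -sum1_count (big_nth 0) szs big_mkcond /=.
  by apply: leq_sum => i _; case: eqP.
pose k0 := Ordinal kn.
exists (fun j => (if j == k0 then c else 0) + d j).
apply/funext => t; rewrite PhD; congr (_ + _).
rewrite /Ph (bigD1 k0) //= eqxx big1 ?addr0; last first.
  by move=> i /negbTE ->; rewrite !mul0r.
rewrite /expmono /h /= opprK sk mulrA; congr (_ * _ ^+ _ * _).
rewrite -Hk /mult_before -sum1_card [RHS]big_mkcond /=.
transitivity (\sum_(0 <= j < n | (- s`_j == - s`_k) && (j < k)%N) 1)%N; last first.
  rewrite big_mkord big_mkcond; apply: eq_bigr => i _; rewrite andbC.
  apply: (congr1 (fun b : bool => if b then 1%N else 0%N)).
  by apply/idP/idP => [Hi|/set_mem]; first exact: mem_set.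
rewrite -(big_nat_widen 0 k n (fun j => - s`_j == - s`_k) (fun=> 1%N)) ?(ltnW kn) //.
rewrite [RHS]big_mkcond /=; apply: eq_bigr => i _; rewrite eqr_opp sk.
by case: eqP.
Qed.

End ComplexCalculus.

(** * Matrix flows with exponential-polynomial entries *)

Section Flow.
Variable R : realType.

(* Putzer's algorithm: peeling the roots [z] of an annihilating polynomial off
   one at a time reduces the system to scalar equations [g' = z g + f], so
   neither a matrix exponential nor uniqueness of solutions is needed. *)
Lemma linear_ode_exppoly n p (B : 'M[R[i]]_n) (s : seq R[i]) (v : 'M[R[i]]_(n, p))
    s0 (f : R -> R[i]) c :
  exppoly s0 f -> foldl (fun w z => (B - z%:M) *m w) v s = 0 ->
  exists y : R -> 'M[R[i]]_(n, p),
    [/\ forall i j, exppoly (s ++ s0) (fun t => y t i j), y 0 = c *: v &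
        forall i j, is_cderive (fun t => y t i j)
                               (fun t => (B *m y t + f t *: v) i j)].
Proof.
elim: s v s0 f c => [|z s IH] v s0 f c Hf /=.
  move=> ->; exists (fun=> 0); split.
  - move=> i j; apply: exppoly_ext (exppoly_nil _) _ => t; by rewrite mxE.
  - by rewrite scaler0.
  - move=> i j; apply: (is_cderive_eq (is_cderive_cst 0)) => t.
      by rewrite mxE.
    by rewrite mulmx0 scaler0 addr0 mxE.
move=> Hv; have [g [Hg g0 dg]] := exppoly_ode z c Hf.
have [y [Hy y0 dy]] := IH _ _ _ 0 Hg Hv.
exists (fun t => g t *: v + y t); split.
- move=> i j.
  have Hc mu : (count_mem mu (s ++ z :: s0) <= count_mem mu ((z :: s) ++ s0))%N.
    by rewrite -cat1s -[z :: s]cat1s !count_cat addnCA addnA.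
  have Hc' mu : (count_mem mu (z :: s0) <= count_mem mu ((z :: s) ++ s0))%N.
    by rewrite -cat1s -[z :: s]cat1s !count_cat -addnA leq_add2l leq_addl.
  apply: (exppoly_ext (exppolyD (exppolyZ (v i j) (exppoly_sub Hc' Hg))
    (exppoly_sub Hc (Hy i j)))) => t.
  by rewrite !mxE mulrC.
- by rewrite g0 y0 scale0r addr0.
- move=> i j.
  apply: (is_cderive_eq (is_cderiveD (is_cderiveZ (v i j) dg) (dy i j))) => t.
    by rewrite !mxE mulrC.
  have -> : B *m (g t *: v + y t) + f t *: v =
      (z * g t + f t) *: v + (B *m y t + g t *: ((B - z%:M) *m v)).
    rewrite mulmxDr mulmxBl scalerBr mul_scalar_mx -scalemxAr scalerA scalerDl.
    rewrite [z * g t]mulrC; apply/matrixP => a b; rewrite !mxE; ring.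
  by rewrite [RHS]mxE; congr (_ + _); rewrite mxE mulrC.
Qed.

(** This turns the annihilation hypothesis of [linear_ode_exppoly] into an instance of
    Cayley-Hamilton. *)
Lemma foldl_horner_mx n (B : 'M[R[i]]_n.+1) (s : seq R[i]) (v : 'M[R[i]]_n.+1) :
  foldl (fun w z => (B - z%:M) *m w) v s =
  horner_mx B (\prod_(z <- s) ('X - z%:P)) *m v.
Proof.
elim: s v => [|z s IH] v /=; first by rewrite big_nil rmorph1 mul1mx.
rewrite IH big_cons mulrC rmorphM /= rmorphB /= horner_mx_X horner_mx_C.
by rewrite -mulmxA.
Qed.

Lemma Re_sum (I : Type) (r : seq I) (F : I -> R[i]) :
  Re (\sum_(i <- r) F i) = \sum_(i <- r) Re (F i).
Proof.
elim: r => [|i r IHr]; first by rewrite !big_nil.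
by rewrite !big_cons complex_ReD IHr.
Qed.

(** The system is solved over the complex numbers with s the roots of the characteristic polynomial,
    and the real part is taken; since B is real, it is again a solution. *)
Lemma flow_exists n (B : 'M[R]_n) : exists (s : seq R[i]) (Y : R -> 'M[R]_n),
  [/\ size s = n,
      forall z, z \in s -> root (char_poly (map_mx (real_complex R) B)) z,
      Y 0 = 1%:M,
      forall t i j, is_derive t (1 : R) (fun u => Y u i j) ((B *m Y t) i j) &
      forall i j, exppoly s (fun t => (Y t i j)%:C%C)].
Proof.
case: n B => [|n] B.
  by exists [::], (fun=> 1%:M); split => // [t|] [].
set Bc := map_mx _ B.
have [s Hs] := closed_field_poly_normal (char_poly Bc).
rewrite (monicP (char_poly_monic Bc)) scale1r in Hs.
have szs : size s = n.+1.
  by have := size_char_poly Bc; rewrite Hs size_prod_XsubC => -[].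
(* The coefficients are real, so the roots are stable under conjugation with multiplicity; this
   keeps Re y = (y + conj y) / 2 in the same span. *)
have sconj : perm_eq s (map conjc s).
  apply: prod_XsubC_eq; rewrite -Hs big_map.
  rewrite (eq_bigr (fun x => map_poly (@conjc R) ('X - x%:P))); last first.
    by move=> z _; rewrite rmorphB /= map_polyX map_polyC.
  rewrite -rmorph_prod -Hs /= -map_char_poly -map_poly_comp.
  by apply: eq_map_poly => x; rewrite /= oppr0.
have [|y [Hy y0 dy]] := @linear_ode_exppoly _ _ Bc s 1%:M [::] (fun=> 0) 1
  (exppoly_nil _).
  by rewrite foldl_horner_mx -Hs Cayley_Hamilton mul0mx.
exists s, (fun t => \matrix_(i, j) Re (y t i j)); split => //.
- by move=> z; rewrite Hs root_prod_XsubC.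
- apply/matrixP => i j; rewrite y0 scale1r !mxE.
  by case: (i == j).
- move=> t i j; have [+ _] := dy i j t.
  rewrite [X in is_derive _ _ X _ -> _](_ : _ =
     (fun u => (\matrix_(i, j) Re (y u i j)) i j)); last first.
    by apply/funext => u; rewrite mxE.
  move/is_derive_eq; apply.
  rewrite scale0r addr0 !mxE Re_sum; apply: eq_bigr => k _.
  by rewrite complex_ReM !mxE /= mul0r subr0.
- move=> i j; rewrite cats0 in Hy.
  have Hj : exppoly s (fun t => conjc (y t i j)).
    apply: exppoly_sub (exppoly_conjc (Hy i j)) => mu.
    by rewrite (permP sconj).
  apply: (exppoly_ext (exppolyZ (2%:R)^-1 (exppolyD (Hy i j) Hj))) => t.
  by rewrite mxE ReJ_add mulrC.
Qed.

End Flow.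

(** * The entrywise maximum norm *)

Section MatrixNorm.
Variable R : realType.

Lemma mx_entry_le m n (M : 'M[R]_(m, n)) i j : `|M i j| <= `|M|.
Proof.
rewrite [leRHS]/Num.norm /= mx_normrE.
by apply: (le_bigmax _ (fun ij : 'I_m * 'I_n => `|M ij.1 ij.2|) (i, j)).
Qed.

Lemma mx_norm_le m n (M : 'M[R]_(m, n)) e : 0 <= e ->
  (forall i j, `|M i j| <= e) -> `|M| <= e.
Proof.
move=> e0 He; rewrite [leLHS]/Num.norm /= mx_normrE.
by apply: bigmax_le => // -[i j] _; apply: He.
Qed.

(** The maximum norm is submultiplicative only up to the number n of summands in each entry. *)
Lemma mulmx_norm_le m n p (A : 'M[R]_(m, n)) (B : 'M[R]_(n, p)) :
  `|A *m B| <= n%:R * `|A| * `|B|.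
Proof.
apply: mx_norm_le => [|i j]; first by rewrite !mulr_ge0.
rewrite mxE (le_trans (ler_norm_sum _ _ _)) //.
have : \sum_(k < n) `|A i k * B k j| <= \sum_(k < n) `|A| * `|B|.
  by apply: ler_sum => k _; rewrite normrM ler_pM ?mx_entry_le.
by rewrite sumr_const card_ord -[X in _ <= X]mulr_natl mulrA.
Qed.

End MatrixNorm.

(** * Entrywise differentiation and integration of matrix functions *)

Section MatrixCalculus.
Variable R : realType.

Definition is_mxderive m n (Y : R -> 'M[R]_(m, n)) t (dY : 'M[R]_(m, n)) :=
  forall i j, is_derive t (1 : R) (fun u => Y u i j) (dY i j).

Lemma is_derive_sum_fun (I : Type) (r : seq I) (h : I -> R -> R) (dh : I -> R) t :
  (forall i, is_derive t (1 : R) (h i) (dh i)) ->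
  is_derive t (1 : R) (fun u => \sum_(i <- r) h i u) (\sum_(i <- r) dh i).
Proof.
move=> H; elim: r => [|i r IH].
  under eq_fun do rewrite big_nil.
  by rewrite big_nil; apply: is_derive_cst.
under eq_fun do rewrite big_cons.
by rewrite big_cons; apply: is_deriveD.
Qed.

Lemma is_derive_scale (h : R -> R) c t dh : is_derive t (1 : R) h dh ->
  is_derive t (1 : R) (fun u => c * h u) (c * dh).
Proof. by move=> H; apply: is_deriveZ. Qed.

Lemma is_mxderive_mull m n p (W : 'M[R]_(p, m)) (Y : R -> 'M[R]_(m, n)) t dY :
  is_mxderive Y t dY -> is_mxderive (fun u => W *m Y u) t (W *m dY).
Proof.
move=> H i j; rewrite mxE; under eq_fun do rewrite mxE.
by apply: is_derive_sum_fun => k; apply: is_derive_scale; apply: H.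
Qed.

Lemma is_mxderive_mulr m n p (W : 'M[R]_(n, p)) (Y : R -> 'M[R]_(m, n)) t dY :
  is_mxderive Y t dY -> is_mxderive (fun u => Y u *m W) t (dY *m W).
Proof.
move=> H i j; rewrite mxE; under eq_fun do rewrite mxE.
apply: is_derive_sum_fun => k; under eq_fun do rewrite mulrC.
by rewrite mulrC; apply: is_derive_scale; apply: H.
Qed.

Lemma is_mxderive_scale m n (f : R -> R) (Y : R -> 'M[R]_(m, n)) t df dY :
  is_derive t (1 : R) f df -> is_mxderive Y t dY ->
  is_mxderive (fun u => f u *: Y u) t (df *: Y t + f t *: dY).
Proof.
move=> Hf H i j; rewrite !mxE; under eq_fun do rewrite mxE.
apply: (is_derive_eq (is_deriveM Hf (H i j))).
by rewrite !scale_regularE addrC [Y t i j * _]mulrC.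
Qed.

Lemma is_mxderive_comp_lin m n (Y : R -> 'M[R]_(m, n)) a t dY :
  is_mxderive Y (a * t) dY -> is_mxderive (fun u => Y (a * u)) t (a *: dY).
Proof.
by move=> H i j; rewrite mxE; apply: (@is_derive_comp_lin _ (fun u => Y u i j)).
Qed.

Lemma is_mxderive_shift m n (Y : R -> 'M[R]_(m, n)) a t dY :
  is_mxderive Y (t - a) dY -> is_mxderive (fun u => Y (u - a)) t dY.
Proof.
move=> H i j.
have Ha : is_derive t (1 : R) (fun u => u - a) 1.
  by apply: (is_derive_eq (is_deriveB (is_derive_id _ _) (is_derive_cst _ _ _)));
    rewrite subr0.
by have := @is_derive1_comp _ (fun u => Y u i j) (fun u => u - a) t _ _ (H i j) Ha;
  rewrite mulr1.
Qed.

Lemma is_derive_continuous (f f' : R -> R) :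
  (forall t, is_derive t (1 : R) f (f' t)) -> continuous f.
Proof.
by move=> H t; have [Hd _] := H t; apply/differentiable_continuous/derivable1_diffP.
Qed.

Lemma ftc_is_derive (G g : R -> R) a b : a <= b ->
  (forall t, is_derive t (1 : R) G (g t)) -> continuous g ->
  (\int[lebesgue_measure]_(s in `[a, b]) (g s)%:E = (G b - G a)%:E)%E.
Proof.
move=> ab dG cg; have cG := is_derive_continuous dG.
move: ab; rewrite le_eqVlt => /predU1P[<-|ab].
  by rewrite set_itv1 integral_set1 subrr.
rewrite (@continuous_FTC2 _ g G a b ab).
- by rewrite EFinB.
- exact: continuous_subspaceT.
- split.
  + by move=> x _; case: (dG x).
  + by apply: cvg_at_right_filter; apply: cG.
  + by apply: cvg_at_left_filter; apply: cG.
- by move=> x _; rewrite derive1E; have [_ ->] := dG x.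
Qed.

Lemma mx_continuous m n (x : R -> 'M[R]_(m, n)) :
  (forall i j, continuous (fun t => x t i j)) -> continuous x.
Proof.
move=> Hx t; apply/cvgrPdist_le => e e0.
have : \forall s \near t, forall ij : 'I_m * 'I_n,
    `|x t ij.1 ij.2 - x s ij.1 ij.2| <= e.
  have Ft := nbhs_filter t.
  apply: (@filter_forall _ _ (fun (ij : ('I_m * 'I_n)%type) s => `|x t ij.1 ij.2 - x s ij.1 ij.2| <= e) _ Ft) => -[i j] /=.
  by have /cvgrPdist_le := Hx i j t; apply.
apply: filterS => s Hs; apply: mx_norm_le => [|i j]; first exact: ltW.
by rewrite !mxE; apply: (Hs (i, j)).
Qed.

End MatrixCalculus.

(** * Trajectories of piecewise constant switching signals *)

Section Trajectories.
Variables (R : realType) (n : nat) (fam : set 'M[R]_n).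

(** Continuity on the whole line makes the integrand measurable everywhere and is preserved by
    concatenation. *)
Definition cont_traj (A : R -> 'M[R]_n) (x : R -> 'cV[R]_n) :=
  switching_traj fam A x /\ forall i, continuous (fun t => x t i ord0).

Lemma smooth_traj M (x : R -> 'cV[R]_n) : fam M ->
  (forall t, is_mxderive x t (M *m x t)) -> cont_traj (fun=> M) x.
Proof.
move=> fM dx.
have cx i : continuous (fun t => x t i ord0).
  by apply: is_derive_continuous => t; apply: dx.
split=> //; split => //.
- by apply: continuous_subspaceT; apply: mx_continuous => i j; rewrite ord1; apply: cx.
- move=> t t0 i; symmetry.
  apply: (@ftc_is_derive _ (fun t => x t i ord0) (fun s => (M *m x s) i ord0)) => //.
    by move=> s; apply: dx.
  apply: is_derive_continuous => s.
  exact: (is_mxderive_mull M (dx s)).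
Qed.

Lemma measurable_mulmx (A : R -> 'M[R]_n) (x : R -> 'cV[R]_n) i :
  (forall i j, measurable_fun [set: R] (fun t : R => A t i j)) ->
  (forall i, continuous (fun t => x t i ord0)) ->
  measurable_fun [set: R] (fun s => (A s *m x s) i ord0).
Proof.
move=> mA cx; under eq_fun do rewrite mxE.
apply: measurable_sum => k; apply: measurable_funM; first exact: mA.
exact: continuous_measurable_fun.
Qed.

(** The signal A is followed up to time T and the constant M afterwards; the integral equation is
    split at T. *)
Lemma concat_traj A x T M (y : R -> 'cV[R]_n) : cont_traj A x -> 0 <= T -> fam M ->
  (forall t, is_mxderive y t (M *m y t)) -> y 0 = x T ->
  exists A' x', [/\ cont_traj A' x', x' 0 = x 0 &
    forall t, 0 <= t -> x' (T + t) = y t].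
Proof.
move=> [[fA mA _ xA] cx] T0 fM dy y0.
pose A' t := if t <= T then A t else M.
pose x' t := if t <= T then x t else y (t - T).
have mA' i j : measurable_fun [set: R] (fun t => A' t i j).
  rewrite (_ : (fun t => _) = fun t => if t <= T then A t i j else M i j).
    by apply: measurable_fun_ifT => //; apply: measurable_fun_ler.
  by apply/funext => t; rewrite /A'; case: ifP.
have cy i : continuous (fun t => y t i ord0).
  by apply: is_derive_continuous => t; apply: dy.
have cx' i : continuous (fun t => x' t i ord0).
  (* Clamping the two arguments at the junction replaces the case distinction by a sum of
     compositions of continuous maps. *)
  have -> : (fun t => x' t i ord0) = (fun t => x (Num.min t T) i ord0 +
      (y (Num.max (t - T) 0) i ord0 - x T i ord0)).
    apply/funext => t; rewrite /x'; have [tT|tT] := leP t T.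
      by rewrite max_r ?subr_le0 // y0 subrr addr0.
    by rewrite max_l ?subr_ge0 ?ltW // [RHS]addrC subrK.
  move=> t; apply: cvgD.
    apply: (@continuous_comp _ _ _ (fun t : R => Num.min t T) (fun t => x t i ord0)).
      by apply: continuous_min; [exact: cvg_id|exact: cvg_cst].
    exact: cx.
  apply: cvgB; last exact: cvg_cst.
  apply: (@continuous_comp _ _ _ (fun t : R => Num.max (t - T) 0) (fun t => y t i ord0)).
    apply: continuous_max; last exact: cvg_cst.
    by apply: cvgB; [exact: cvg_id|exact: cvg_cst].
  exact: cy.
have xx' t : t <= T -> x' t = x t by rewrite /x' => ->.
have yx' t : T <= t -> x' t = y (t - T).
  rewrite /x' le_eqVlt => /predU1P[<-|tT]; first by rewrite lexx subrr y0.
  by rewrite leNgt tT.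
exists A', x'; split; last 2 first.
- by rewrite xx'.
- by move=> t t0; rewrite yx' ?lerDl // addrC addKr.
split=> //; split => //.
- by move=> t t0; rewrite /A'; case: ifP => // _; apply: fA.
- by apply: continuous_subspaceT; apply: mx_continuous => i j; rewrite ord1; apply: cx'.
have int_le t i : 0 <= t -> t <= T ->
    ((x' t i ord0 - x 0 i ord0)%:E =
     \int[lebesgue_measure]_(s in `[0%R, t]) ((A' s *m x' s) i ord0)%:E)%E.
  move=> t0 tT; rewrite xx' // (xA _ t0).
  apply: eq_integral => s; rewrite inE /= in_itv /= => /andP[_ st].
  by rewrite /A' /x' (le_trans st tT).
move=> t t0 i; rewrite [x' 0]xx' //.
have [tT|tT] := leP t T; first exact: int_le.
rewrite (@itv_bndbnd_setU _ _ (BLeft 0) (BRight T) (BRight t)) ?bnd_simp // ?ltW //.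
have mf : measurable_fun [set: R] (fun s => ((A' s *m x' s) i ord0)%:E).
  by apply/measurable_EFinP; apply: measurable_mulmx.
rewrite integral_setU //=; last 2 first.
- exact: measurable_funTS.
- rewrite /disj_set; apply/eqP/seteqP; split => // s [] /=.
  by rewrite !in_itv /= => /andP[_ sT] /andP[]; rewrite ltNge sT.
rewrite -int_le //.
have dy' s : is_mxderive (fun u => y (u - T)) s (M *m y (s - T)).
  exact: is_mxderive_shift.
have cMy : continuous (fun s => (M *m y (s - T)) i ord0).
  by apply: is_derive_continuous => s; apply: is_mxderive_mull (dy' s) i ord0.
have -> : (\int[lebesgue_measure]_(s in `]T, t]) ((A' s *m x' s) i ord0)%:E =
    \int[lebesgue_measure]_(s in `]T, t]) ((M *m y (s - T)) i ord0)%:E)%E.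
  apply: eq_integral => s; rewrite inE /= in_itv /= => /andP[Ts _].
  by rewrite yx' ?ltW // /A' leNgt Ts.
(* Adding the null point T closes the interval, as the fundamental theorem of calculus requires. *)
rewrite integral_itv_obnd_cbnd; last first.
  apply: measurable_funTS; apply/measurable_EFinP.
  exact: (continuous_measurable_fun cMy).
rewrite (@ftc_is_derive _ _ _ _ _ (ltW tT) (fun s => dy' s i ord0) cMy).
by rewrite -EFinD /= yx' ?(ltW tT) // yx' // !subrr; congr (_%:E); ring.
Qed.


(* [reach F T Phi]: Phi is the transition matrix over time T of a piecewise
   constant switching signal, [F A] being the flow of A. *)
Inductive reach (F : 'M[R]_n -> R -> 'M[R]_n) : R -> 'M[R]_n -> Prop :=
| reach0 : reach F 0 1%:M
| reachS A t T Phi : fam A -> 0 <= t -> reach F T Phi ->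
    reach F (T + t) (F A t *m Phi).

Section Reach.
Variable F : 'M[R]_n -> R -> 'M[R]_n.
Hypothesis F0 : forall A, F A 0 = 1%:M.
Hypothesis dF : forall A t, is_mxderive (F A) t (A *m F A t).

Lemma reach_ge0 T Phi : reach F T Phi -> 0 <= T.
Proof. by elim => // A t {}T {}Phi _ t0 _ T0; apply: addr_ge0. Qed.

(** [reach] appends later phases on the left; the extremal norm needs an initial phase, hence a
    factor on the right. *)
Lemma reach_rcons A t T Phi : fam A -> 0 <= t -> reach F T Phi ->
  reach F (t + T) (Phi *m F A t).
Proof.
move=> fA t0; elim => [|B s {}T {}Phi fB s0 _ IH].
  by have := reachS fA t0 (reach0 F); rewrite add0r mulmx1 addr0 mul1mx.
by rewrite addrA -mulmxA; apply: reachS.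
Qed.

Lemma is_mxderive_flow_mul A (v : 'cV[R]_n) t :
  is_mxderive (fun u => F A u *m v) t (A *m (F A t *m v)).
Proof. by rewrite mulmxA; apply: is_mxderive_mulr. Qed.

(** Growth bounds on trajectories thereby pass to transition matrices. At time 0 any member of the
    family serves as the signal. *)
Lemma reach_traj T Phi (x0 : 'cV[R]_n) : (fam !=set0)%classic -> reach F T Phi ->
  exists A x, [/\ cont_traj A x, x 0 = x0 & x T = Phi *m x0].
Proof.
move=> [A0 fA0]; elim => [|B s {}T {}Phi fB s0 rT [A [x [tx xx0 xT]]]].
  exists (fun=> A0), (fun t => F A0 t *m x0); split.
  - by apply: smooth_traj => // t; apply: is_mxderive_flow_mul.
  - by rewrite F0 mul1mx.
  - by rewrite F0.
have [|A' [x' [tx' x'0 Hx']]] := concat_traj tx (reach_ge0 rT) fB (is_mxderive_flow_mul B (x T)).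
  by rewrite F0 mul1mx.
by exists A', x'; split => //; rewrite ?x'0 // Hx' // xT mulmxA.
Qed.

End Reach.
End Trajectories.

(** * Bounding the joint spectral radius by a contracted norm *)

Section JointSpectralRadius.
Variable R : realType.

Lemma cvg_powR_invS (C : R) : 0 < C ->
  ((fun k : nat => C `^ (k.+1%:R)^-1) @ \oo --> (1 : R))%classic.
Proof.
move=> C0.
rewrite (_ : (fun k : nat => _) = expR \o (fun k : nat => k.+1%:R^-1 * ln C)); last first.
  by apply/funext => k /=; rewrite /powR gt_eqF.
have H : ((fun k : nat => k.+1%:R^-1 * ln C) @ \oo --> 0 * ln C)%classic.
  by apply: cvgM; [exact: (@cvg_harmonic R)|exact: cvg_cst].
have := continuous_cvg _ (@continuous_expR R (0 * ln C)) H.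
by rewrite mul0r expR0; apply; apply: eventually_filter.
Qed.

(** A product of k factors contracts N by lam^k, so its matrix norm is at most C lam^k; the k-th
    root of C tends to 1. *)
Lemma jsr_lt1 n (B : set 'M[R]_n) (N : 'cV[R]_n -> R) (C lam : R) :
  (B !=set0)%classic -> 0 < C -> 0 <= lam -> lam < 1 ->
  (forall x, `|x| <= N x) -> (forall x, N x <= C * `|x|) ->
  (forall M x, B M -> N (M *m x) <= lam * N x) -> jsr B < 1.
Proof.
move=> [M0 BM0] C0 lam0 lam1 N1 N2 HN.
rewrite /jsr; set u := (fun k : nat => sup _).
have prod_le s x : (forall M, M \in s -> B M) ->
    N (foldr (@mulmx R n n n) 1%:M s *m x) <= lam ^+ size s * N x.
  elim: s => [|M s IH] Bs /=; first by rewrite mul1mx expr0 mul1r.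
  rewrite -mulmxA exprS -mulrA; apply: (le_trans (HN _ _ _)).
    by apply: Bs; rewrite mem_head.
  by rewrite ler_wpM2l // IH // => M' M's; apply: Bs; rewrite inE M's orbT.
have norm_le s : (forall M, M \in s -> B M) ->
    `|foldr (@mulmx R n n n) 1%:M s| <= lam ^+ size s * C.
  move=> Bs; apply: mx_norm_le => [|i j]; first by rewrite mulr_ge0 ?exprn_ge0 // ltW.
  set P := foldr _ _ _.
  (* Bounds on vectors reach the entries of P through basis vectors, whose norm is at most 1. *)
  have -> : P i j = (P *m (delta_mx j ord0 : 'cV[R]_n)) i ord0.
    by rewrite -colE mxE.
  apply: le_trans (mx_entry_le _ _ _) _; apply: le_trans (N1 _) _.
  apply: le_trans (prod_le _ _ Bs) _; rewrite ler_wpM2l ?exprn_ge0 //.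
  apply: le_trans (N2 _) _; apply: ler_piMr; first exact: ltW.
  apply: mx_norm_le => // a b; rewrite mxE.
  by case: (_ && _); rewrite ?normr1 ?normr0.
have ule k : u k <= lam * C `^ (k.+1%:R)^-1.
  rewrite /u; apply: ge_sup.
    exists (`|foldr (@mulmx R n n n) 1%:M (nseq k.+1 M0)| `^ (k.+1%:R)^-1).
    exists (nseq k.+1 M0) => //; split; first by rewrite size_nseq.
    by move=> M; rewrite mem_nseq => /eqP ->.
  move=> _ [s [szs Bs] <-].
  have -> : lam * C `^ (k.+1%:R)^-1 = (lam ^+ k.+1 * C) `^ (k.+1%:R)^-1.
    rewrite powRM ?exprn_ge0 // ?ltW //; congr (_ * _).
    by rewrite -powR_mulrn // -powRrM mulfV ?pnatr_eq0 // powRr1.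
  apply: ge0_ler_powR; rewrite ?nnegrE ?invr_ge0 //.
    by rewrite mulr_ge0 ?exprn_ge0 // ltW.
  by rewrite -szs; apply: norm_le.
have [cu|ncu] := pselect (cvg (u @ \oo))%classic; last first.
  (* junk value: a divergent [limn] is [point = 0] *)
  by rewrite (dvgP ncu) ltr01.
have cv : ((fun k : nat => lam * C `^ (k.+1%:R)^-1) @ \oo --> lam)%classic.
  have := cvgM (@cvg_cst _ lam nat \oo%classic _) (cvg_powR_invS C0).
  by rewrite mulr1; apply.
apply: le_lt_trans lam1; rewrite -(cvg_lim (@Rhausdorff R) cv).
by apply: ler_lim => //; [apply/cvg_ex; exists lam|apply: nearW].
Qed.

End JointSpectralRadius.

(** * A second-order Taylor estimate *)

Section Taylor.
Variable R : realType.

(** The first-order part at 0 differs from q(u) by at most u^2 b / 2. A one-sided version is applied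
    to q and to - q. *)
Lemma taylor2_le (q dq ddq : R -> R) (a b u : R) : 0 <= u ->
  (forall t, is_derive t (1 : R) q (dq t)) ->
  (forall t, is_derive t (1 : R) dq (ddq t)) ->
  (forall t, 0 <= t -> `|q t| <= a) ->
  (forall t, 0 <= t -> `|ddq t| <= b) ->
  `|q 0 + u * dq 0| <= a + u ^+ 2 / 2 * b.
Proof.
move=> u0.
suff H (g dg ddg : R -> R) : (forall t, is_derive t (1 : R) g (dg t)) ->
    (forall t, is_derive t (1 : R) dg (ddg t)) ->
    (forall t, 0 <= t -> g t <= a) ->
    (forall t, 0 <= t -> - b <= ddg t) ->
    g 0 + u * dg 0 <= a + u ^+ 2 / 2 * b.
  move=> dq1 dq2 qa qb; rewrite ler_norml; apply/andP; split; last first.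
    apply: (H q dq ddq) => // t t0; first exact: le_trans (ler_norm _) (qa _ t0).
    by have := qb _ t0; rewrite ler_norml => /andP[].
  rewrite lerNl opprD -mulrN.
  apply: (H (fun t => - q t) (fun t => - dq t) (fun t => - ddq t)) => t.
  - by move=> t0; have := qa _ t0; rewrite ler_norml lerNl => /andP[].
  - by move=> t0; have := qb _ t0; rewrite ler_norml lerN2 => /andP[].
move=> Dg Ddg ga gb.
(* Adding the parabola makes the function convex on the half-line, so its tangent at 0 lies below
   it. *)
pose G t := g t + b / 2 * (t * t); pose dG t := dg t + b * t.
have DG t : is_derive t (1 : R) G (dG t).
  apply: (is_derive_eq (is_deriveD (Dg t) (is_derive_scale (b / 2)
    (is_deriveM (is_derive_id t 1) (is_derive_id t 1))))).
  by rewrite /dG !scale_regularE; field.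
have DdG t : is_derive t (1 : R) dG (ddg t + b).
  apply: (is_derive_eq (is_deriveD (Ddg t) (is_derive_scale b (is_derive_id t 1)))).
  by rewrite mulr1.
have cG : continuous G := is_derive_continuous DG.
have cdG : continuous dG := is_derive_continuous DdG.
have [c] := MVT_segment u0 (fun x _ => DG x) (continuous_subspaceT cG).
rewrite in_itv /= => /andP[c0 cu] Ec.
have [d] := MVT_segment c0 (fun x _ => DdG x) (continuous_subspaceT cdG).
rewrite in_itv /= => /andP[d0 _] Ed.
have : 0 <= (ddg d + b) * (c - 0).
  by rewrite mulr_ge0 ?subr0 // -lerBlDr sub0r gb.
rewrite -Ed subr_ge0 => dGc.
have : G 0 + u * dG 0 <= G u.
  by rewrite -lerBrDl Ec subr0 mulrC ler_wpM2r.
rewrite /G /dG !mulr0 !addr0 => /le_trans; apply.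
rewrite lerD ?ga //.
by rewrite (_ : u ^+ 2 / 2 * b = b / 2 * (u * u)) //; field.
Qed.

End Taylor.

(** * The extremal norm of the discounted system *)

Section ExtremalNorm.
Variables (R : realType) (n : nat) (fam : set 'M[R]_n) (eps rho : R).
Hypotheses (eps0 : 0 < eps) (rho0 : 0 < rho).
Variable Y : 'M[R]_n -> R -> 'M[R]_n.

Definition scaled_shift (A : 'M[R]_n) := rho^-1 *: (A + eps%:M).
Local Notation B := scaled_shift.

(** With [Y A] the flow of B = (A + eps) / rho, this is e^{tA}, because A = rho B - eps. *)
Definition flow (A : 'M[R]_n) (t : R) := expR (- eps * t) *: Y A (rho * t).

Hypothesis Y0 : forall A, Y A 0 = 1%:M.
Hypothesis dY : forall A t, is_mxderive (Y A) t (B A *m Y A t).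

Lemma flow0 A : flow A 0 = 1%:M.
Proof. by rewrite /flow !mulr0 expR0 scale1r Y0. Qed.

Lemma dflow A t : is_mxderive (flow A) t (A *m flow A t).
Proof.
have dexp := is_derive_comp_lin (is_derive_expR (- eps * t)).
have := is_mxderive_scale dexp (is_mxderive_comp_lin (dY A (rho * t))).
rewrite /flow /B; congr is_mxderive.
have -> : rho *: (rho^-1 *: (A + eps%:M) *m Y A (rho * t)) =
    A *m Y A (rho * t) + eps *: Y A (rho * t).
  rewrite -scalemxAl scalerA mulfV ?gt_eqF // scale1r.
  by rewrite mulmxDl mul_scalar_mx.
rewrite scalerDr scalerA -scalemxAr addrCA [_ * eps]mulrC -scalerDl.
by rewrite -mulrDl addNr mul0r scale0r addr0.
Qed.

Variable C : R.
Hypothesis C0 : 0 < C.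
Hypothesis growth : forall T Phi, reach fam flow T Phi ->
  forall x : 'cV[R]_n, expR (eps * T) * `|Phi *m x| <= C * `|x|.

Definition orbit_norms (x : 'cV[R]_n) : set R :=
  [set z | exists T Phi, reach fam flow T Phi /\ z = expR (eps * T) * `|Phi *m x|].

Definition extremal_norm (x : 'cV[R]_n) := sup (orbit_norms x).
Local Notation f := extremal_norm.

Lemma extremal_norm_ge T Phi x : reach fam flow T Phi ->
  expR (eps * T) * `|Phi *m x| <= f x.
Proof.
move=> HT; apply: sup_upper_bound; last by exists T, Phi.
split; first by exists (expR (eps * T) * `|Phi *m x|), T, Phi.
by exists (C * `|x|) => _ [T' [Phi' [HT' ->]]]; apply: growth.
Qed.

Lemma extremal_norm_le x b :
  (forall T Phi, reach fam flow T Phi -> expR (eps * T) * `|Phi *m x| <= b) ->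
  f x <= b.
Proof.
move=> H; apply: ge_sup; last by move=> _ [T [Phi [HT ->]]]; apply: H.
by exists (expR (eps * 0) * `|1%:M *m x|), 0, 1%:M; split => //; apply: reach0.
Qed.

Lemma norm_le_extremal x : `|x| <= f x.
Proof.
have := @extremal_norm_ge 0 1%:M x (reach0 _ _).
by rewrite mulr0 expR0 mul1r mul1mx.
Qed.

Lemma extremal_le_norm x : f x <= C * `|x|.
Proof. by apply: extremal_norm_le => T Phi HT; apply: growth. Qed.

Lemma extremal_norm_ge0 x : 0 <= f x.
Proof. exact: le_trans (norm_le_extremal x). Qed.

Lemma extremal_normZ c x : 0 <= c -> f (c *: x) <= c * f x.
Proof.
move=> c0; apply: extremal_norm_le => T Phi HT.
rewrite -scalemxAr mx_normZ ger0_norm // mulrCA ler_wpM2l //.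
exact: extremal_norm_ge.
Qed.

(** Running A for time u / rho before Phi is admissible; the extra discount e^{eps u / rho} cancels
    the scalar factor in [flow]. *)
Lemma reach_flow_bound T Phi A u x : reach fam flow T Phi -> fam A -> 0 <= u ->
  expR (eps * T) * `|Phi *m (Y A u *m x)| <= f x.
Proof.
move=> HT fA u0.
have t0 : 0 <= u / rho by rewrite divr_ge0 // ltW.
have := extremal_norm_ge x (reach_rcons fA t0 HT).
rewrite /flow -scalemxAr -scalemxAl mx_normZ ger0_norm ?expR_ge0 //.
have -> : rho * (u / rho) = u by field; rewrite gt_eqF.
rewrite mulrA -expRD.
by rewrite mulrDr mulNr addrAC subrr add0r -mulmxA.
Qed.

(* Along the shifted flow every coordinate of the discounted orbit is bounded
   by the norm of [x], so Taylor's formula bounds its first-order part. *)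
Lemma extremal_euler_le A x K u : fam A -> 0 <= K -> 0 <= u ->
  (forall T Phi i v, reach fam flow T Phi -> 0 <= v ->
    `|expR (eps * T) * (Phi *m (B A *m (B A *m Y A v) *m x)) i ord0| <= K * f x) ->
  f (x + u *: (B A *m x)) <= (1 + u ^+ 2 / 2 * K) * f x.
Proof.
move=> fA K0 u0 HK; apply: extremal_norm_le => T Phi HT.
have b0 : 0 <= (1 + u ^+ 2 / 2 * K) * f x.
  by rewrite mulr_ge0 ?extremal_norm_ge0 // addr_ge0 // !mulr_ge0 ?sqr_ge0 ?invr_ge0.
rewrite -[expR _]ger0_norm ?expR_ge0 // -mx_normZ.
apply: mx_norm_le => // i j; rewrite ord1 {j}.
pose q v := expR (eps * T) * (Phi *m (Y A v *m x)) i ord0.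
pose dq v := expR (eps * T) * (Phi *m (B A *m Y A v *m x)) i ord0.
pose ddq v := expR (eps * T) * (Phi *m (B A *m (B A *m Y A v) *m x)) i ord0.
have := @taylor2_le R q dq ddq (f x) (K * f x) u u0.
rewrite /q /dq Y0 mul1mx mulmx1.
have -> : expR (eps * T) * (Phi *m x) i ord0 +
    u * (expR (eps * T) * (Phi *m (B A *m x)) i ord0) =
    (expR (eps * T) *: (Phi *m (x + u *: (B A *m x)))) i ord0.
  by rewrite mulmxDr -scalemxAr !mxE; ring.
rewrite mulrDl mul1r -[_ * K * _]mulrA; apply.
- move=> t; apply: is_derive_scale.
  exact: (is_mxderive_mull Phi (is_mxderive_mulr x (dY _ _)) i ord0).
- move=> t; apply: is_derive_scale.
  exact: (is_mxderive_mull Phi (is_mxderive_mulr x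
    (is_mxderive_mull (B A) (dY _ _))) i ord0).
- move=> t t0; rewrite normrM [`|expR _|]ger0_norm ?expR_ge0 //.
  apply: le_trans (reach_flow_bound x HT fA t0).
  by rewrite ler_wpM2l ?expR_ge0 // mx_entry_le.
- by move=> t t0; apply: HK.
Qed.

(** Since A = rho B - eps, one has I + tau A = c (I + u B) with c = 1 - eps tau and u = rho tau / c;
    the factor c (1 + u^2 K / 2) is the one stated. *)
Lemma extremal_contraction A x K tau : fam A -> 0 <= K -> 0 < tau ->
  eps * tau < 1 ->
  (forall T Phi i v, reach fam flow T Phi -> 0 <= v ->
    `|expR (eps * T) * (Phi *m (B A *m (B A *m Y A v) *m x)) i ord0| <= K * f x) ->
  f ((1%:M + tau *: A) *m x) <=
  (1 - eps * tau + rho ^+ 2 * tau ^+ 2 * K / (2 * (1 - eps * tau))) * f x.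
Proof.
move=> fA K0 tau0 et1 HK; set c := 1 - eps * tau.
have c0 : 0 < c by rewrite subr_gt0.
pose u := rho * tau / c.
have u0 : 0 <= u by rewrite divr_ge0 ?mulr_ge0 ?ltW.
have -> : (1%:M + tau *: A) *m x = c *: (x + u *: (B A *m x)).
  rewrite mulmxDl mul1mx -scalemxAl scalerDr scalerA /u.
  rewrite [c * _]mulrC divfK ?gt_eqF // /B -scalemxAl scalerA.
  rewrite mulrAC mulfV ?gt_eqF // mul1r mulmxDl mul_scalar_mx scalerDr scalerA.
  by rewrite addrCA -scalerDl /c [tau * _]mulrC subrK scale1r addrC.
apply: le_trans (extremal_normZ _ (ltW c0)) _.
have := extremal_euler_le fA K0 u0 HK.
rewrite -(ler_pM2l c0) => /le_trans; apply.
rewrite mulrA ler_wpM2r ?extremal_norm_ge0 // le_eqVlt; apply/orP; left; apply/eqP.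
by rewrite /u; field; rewrite gt_eqF.
Qed.

Hypothesis fam0 : (fam !=set0)%classic.

(** The inequality on tau is lam < 1 with the denominator 2 (1 - eps tau) cleared and one factor tau
    cancelled. *)
Lemma jsr_euler_lt1 K tau : 0 <= K -> 0 < tau ->
  tau * (rho ^+ 2 * K + 2 * eps ^+ 2) < 2 * eps ->
  (forall A x T Phi i v, fam A -> reach fam flow T Phi -> 0 <= v ->
    `|expR (eps * T) * (Phi *m (B A *m (B A *m Y A v) *m x)) i ord0| <= K * f x) ->
  jsr [set 1%:M + tau *: M | M in fam]%classic < 1.
Proof.
move=> K0 tau0 Htau HK.
have rK : 0 <= rho ^+ 2 * K by rewrite mulr_ge0 ?sqr_ge0.
(* Dropping the nonnegative term rho^2 K from the hypothesis already gives this. *)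
have et1 : eps * tau < 1.
  have : tau * (2 * eps ^+ 2) <= tau * (rho ^+ 2 * K + 2 * eps ^+ 2).
    by rewrite ler_wpM2l ?(ltW tau0) // lerDr.
  move=> /le_lt_trans/(_ Htau).
  by rewrite (_ : tau * (2 * eps ^+ 2) = 2 * eps * (eps * tau)); [
    rewrite gtr_pMr // mulr_gt0|ring].
set lam := 1 - eps * tau + rho ^+ 2 * tau ^+ 2 * K / (2 * (1 - eps * tau)).
have c0 : 0 < 1 - eps * tau by rewrite subr_gt0.
apply: (@jsr_lt1 R n _ f C lam) => //.
- by case: fam0 => M fM; exists (1%:M + tau *: M), M.
- rewrite addr_ge0 ?(ltW c0) // divr_ge0 ?mulr_ge0 ?sqr_ge0 //; exact: ltW.
- rewrite /lam -ltrBrDl opprB addrCA subrr addr0 ltr_pdivrMr ?mulr_gt0 //.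
  rewrite -subr_gt0 (_ : _ - _ = tau * (2 * eps - tau * (rho ^+ 2 * K + 2 * eps ^+ 2)));
    last by ring.
  by rewrite mulr_gt0 // subr_gt0.
- exact: norm_le_extremal.
- exact: extremal_le_norm.
- by move=> _ x [A fA <-]; apply: extremal_contraction => // *; apply: HK.
Qed.

End ExtremalNorm.

(** * The modulus of complex numbers *)

Section Modulus.
Variable R : realType.
Implicit Types z : R[i].

Lemma normc_sqr z : normc z ^+ 2 = Re z ^+ 2 + Im z ^+ 2.
Proof. by case: z => a b /=; rewrite sqr_sqrtr // addr_ge0 ?sqr_ge0. Qed.

Lemma normc_real_complex (a : R) : normc a%:C%C = `|a|.
Proof. by rewrite /= expr0n /= addr0 sqrtr_sqr. Qed.

Lemma Re_realM (a : R) z : Re (a%:C%C * z) = a * Re z.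
Proof. by case: z => b c /=; rewrite mul0r subr0. Qed.

Lemma normc_ge0 z : 0 <= normc z.
Proof. by case: z => a b /=; apply: sqrtr_ge0. Qed.

Lemma Re_le_normc z : `|Re z| <= normc z.
Proof.
by rewrite -ler_sqr ?nnegrE ?normc_ge0 // normc_sqr real_normK ?num_real // lerDl sqr_ge0.
Qed.

Lemma normc_le_ReIm z : normc z <= `|Re z| + `|Im z|.
Proof.
rewrite -ler_sqr ?nnegrE ?normc_ge0 ?addr_ge0 // normc_sqr sqrrD.
rewrite !real_normK ?num_real // -addrA [X in _ <= _ + X]addrC addrA lerDl.
by rewrite mulrn_wge0 ?mulr_ge0.
Qed.

Lemma normc_cexp z (t : R) : normc (cexp (z * t%:C%C)) = expR (Re z * t).
Proof.
rewrite cexpE /= !exprMn -mulrDr cos2Dsin2 mulr1 sqrtr_sqr ger0_norm //.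
Qed.

End Modulus.

(** * Eigenvalues and the growth of trajectories *)

Section Eigenvalues.
Variable R : realType.
Local Notation cmx := (map_mx (real_complex R)).

Lemma char_poly_tr (F : fieldType) n (M : 'M[F]_n) : char_poly M^T = char_poly M.
Proof.
rewrite /char_poly -det_tr; congr (\det _).
by apply/matrixP => i j; rewrite !mxE eq_sym.
Qed.

(** [eigenvalue] concerns row vectors while trajectories are columns; transposition keeps the
    characteristic polynomial. *)
Lemma root_char_poly_eigenvector (F : fieldType) n (M : 'M[F]_n) mu :
  root (char_poly M) mu -> exists2 v : 'cV[F]_n, M *m v = mu *: v & v != 0.
Proof.
rewrite -char_poly_tr -eigenvalue_root_char => /eigenvalueP[v Hv v0].
exists v^T; last by rewrite trmx_eq0.
by apply: trmx_inj; rewrite trmx_mul trmxK Hv linearZ /= trmxK.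
Qed.

Lemma root_char_poly_scaled_shift n (A : 'M[R]_n) eps rho z : 0 < rho ->
  root (char_poly (cmx (scaled_shift eps rho A))) z ->
  root (char_poly (cmx A)) (rho%:C%C * z - eps%:C%C).
Proof.
move=> rho0; rewrite -!eigenvalue_root_char => /eigenvalueP[v Hv v0].
apply/eigenvalueP; exists v => //.
have -> : A = rho *: scaled_shift eps rho A - eps%:M.
  by rewrite /scaled_shift scalerA mulfV ?gt_eqF // scale1r addrK.
rewrite map_mxB map_mxZ map_scalar_mx mulmxBr -scalemxAr Hv scalerA.
by rewrite mul_mx_scalar -scalerBl.
Qed.

(** For an eigenvector v, the real part of w e^{mu t} v is a trajectory of the constant signal A,
    which outgrows e^{a t} if Re mu > a. *)
Lemma eigenvalue_growth n (fam : set 'M[R]_n) A a C mu : fam A ->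
  (forall A x, switching_traj fam A x ->
    forall t, 0 <= t -> `|x t| <= C * expR (a * t) * `|x 0|) ->
  root (char_poly (cmx A)) mu -> Re mu <= a.
Proof.
move=> fA HC /root_char_poly_eigenvector[v Hv /matrix0Pn[i [j]]].
rewrite ord1 {j} => vi0; rewrite leNgt; apply/negP => amu.
(* The choices w = 1 and w = i control the real and the imaginary part, hence the modulus. *)
pose x (w : R[i]) t : 'cV[R]_n := \col_k Re (w * v k ord0 * cexp (mu * t%:C%C)).
have dx w t : is_mxderive (x w) t (A *m x w t).
  move=> k l; rewrite ord1 {l}; under eq_fun do rewrite mxE.
  have [+ _] := is_cderiveZ (w * v k ord0) (is_cderive_cexp mu) t.
  move/is_derive_eq; apply.
  have -> : w * v k ord0 * (mu * cexp (mu * t%:C%C)) =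
      (cmx A *m v) k ord0 * (w * cexp (mu * t%:C%C)).
    by rewrite Hv mxE; ring.
  rewrite !mxE mulr_suml Re_sum; apply: eq_bigr => l _; rewrite !mxE.
  by rewrite -mulrA Re_realM; congr (_ * Re _); ring.
have Hx w t : 0 <= t -> `|Re (w * v i ord0 * cexp (mu * t%:C%C))| <=
    C * expR (a * t) * `|x w 0|.
  move=> t0; have [st _] := smooth_traj fA (dx w).
  apply: le_trans (HC _ _ st _ t0).
  by have := mx_entry_le (x w t) i ord0; rewrite mxE.
pose D := C * (`|x 1 0| + `|x 'i%C 0|) / normc (v i ord0).
have nv : 0 < normc (v i ord0).
  rewrite lt_neqAle normc_ge0 andbT eq_sym; apply: contra vi0 => /eqP/ComplexField.Normc.eq0_normc.
  by move=> ->.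
have HD t : 0 <= t -> expR ((Re mu - a) * t) <= D.
  move=> t0; rewrite /D ler_pdivlMr // mulrBl expRD expRN mulrAC ler_pdivrMr ?expR_gt0 //.
  rewrite -normc_cexp -ComplexField.Normc.normcM [cexp _ * _]mulrC.
  apply: le_trans (normc_le_ReIm _) _.
  rewrite [X in _ <= X]mulrAC mulrDr; apply: lerD.
    by have := Hx 1 t t0; rewrite mul1r.
  have := Hx 'i%C t t0; rewrite -[in Re _]mulrA [in Re _]mulrC ReiNIm normrN.
  by [].
have am0 : 0 < Re mu - a by rewrite subr_gt0.
have D0 : 0 <= D by apply: le_trans (HD 0 _); rewrite ?expR_ge0.
(* At this time e^{(Re mu - a) t} is at least 1 + D, contradicting the bound D. *)
have := le_trans (expR_ge1Dx _) (HD (D / (Re mu - a)) (divr_ge0 D0 (ltW am0))).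
by rewrite mulrCA mulfV ?gt_eqF // mulr1 leNgt ltrDr ltr01.
Qed.

End Eigenvalues.

(** * Using and estimating M_{2,n} *)

Section ExponentialSums.
Variable R : realType.

(** As q is real, q'' is the real part of [deriv2C], which the modulus dominates; the rest unfolds
    the nested suprema. *)
Lemma Dn_M2n_ge n (h c : 'I_n -> R[i]) (q dq ddq : R -> R) :
  @Dn R n h -> (forall t, Ph h c t = (q t)%:C%C) ->
  (forall t, is_derive t (1 : R) q (dq t)) ->
  (forall t, is_derive t (1 : R) dq (ddq t)) ->
  (forall t, 0 <= t -> `|q t| <= 1) ->
  forall t, 0 <= t -> (`|ddq t|%:E <= M2n R n)%E.
Proof.
move=> Dh Ec Dq Ddq q1 t t0.
have d1 (f df : R -> R) : (forall t, is_derive t (1 : R) f (df t)) -> derive1 f = df.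
  by move=> H; apply/funext => s; rewrite derive1E; have [_ ->] := H s.
apply: (@le_trans _ _ (M2 h)); last by apply: ereal_sup_ubound; exists h.
apply: (@le_trans _ _ (supn (deriv2C (Ph h c)))); last first.
  apply: ereal_sup_ubound; exists c => //.
  apply: ge_ereal_sup => z [s /=]; rewrite in_itv /= andbT => s0 <-.
  by rewrite Ec normc_real_complex lee_fin q1.
apply: (@le_trans _ _ (normc (deriv2C (Ph h c) t))%:E); last first.
  by apply: ereal_sup_ubound; exists t => //=; rewrite in_itv /= t0.
rewrite lee_fin; apply: le_trans (Re_le_normc _).
rewrite /deriv2C /=; under [X in derive1 (derive1 X)]eq_fun do rewrite Ec /=.
by rewrite (d1 _ _ Dq) (d1 _ _ Ddq).
Qed.

Lemma M2n_bound n (h c : 'I_n -> R[i]) (q dq ddq : R -> R) (F M : R) :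
  @Dn R n h -> (forall t, Ph h c t = (q t)%:C%C) ->
  (forall t, is_derive t (1 : R) q (dq t)) ->
  (forall t, is_derive t (1 : R) dq (ddq t)) ->
  0 < F -> (forall t, 0 <= t -> `|q t| <= F) -> M2n R n = M%:E ->
  forall t, 0 <= t -> `|ddq t| <= M * F.
Proof.
move=> Dh Ec Dq Ddq F0 qF EM t t0.
have := @Dn_M2n_ge n h (fun k => F^-1%:C%C * c k) (fun t => F^-1 * q t)
  (fun t => F^-1 * dq t) (fun t => F^-1 * ddq t) Dh _ _ _ _ t t0.
rewrite EM lee_fin normrM gtr0_norm ?invr_gt0 // mulrC ler_pdivrMr //.
apply => {t t0} t.
- rewrite rmorphM /= -Ec /Ph mulr_sumr; apply: eq_bigr => k _.
  by rewrite !mulrA.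
- by move=> t0; rewrite normrM gtr0_norm ?invr_gt0 // mulrC ler_pdivrMr // mul1r qF.
Qed.

Lemma expmono_N1 m (t : R) : expmono m (-1) t = (t ^+ m * expR (- t))%:C%C.
Proof.
rewrite /expmono cexpE rmorphM rmorphXn /=; congr (_ * _).
by rewrite oppr0 mul0r cos0 sin0 mulr1 mulr0 mulN1r.
Qed.

(** Lower bounds come from test functions for h = (1, ..., 1), a point of D_n whose space is spanned
    by t^k e^{-t}, k < n. *)
Lemma M2n_ge_N1 n (f : R -> R[i]) (q dq ddq : R -> R) : (0 < n)%N ->
  exppoly (nseq n (-1)) f -> (forall t, f t = (q t)%:C%C) ->
  (forall t, is_derive t (1 : R) q (dq t)) ->
  (forall t, is_derive t (1 : R) dq (ddq t)) ->
  (forall t, 0 <= t -> `|q t| <= 1) -> (`|ddq 0|%:E <= M2n R n)%E.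
Proof.
move=> n0 Hf fq Dq Ddq q1.
have [c Ec] := exppoly_Ph (size_nseq n (-1 : R[i])) Hf.
apply: (Dn_M2n_ge _ _ Dq Ddq q1 (lexx 0)); last by move=> t; rewrite -fq Ec.
move=> k; rewrite nth_nseq ltn_ord opprK; split; last by rewrite /= ltr01.
by rewrite ComplexField.Normc.normc1.
Qed.

Lemma is_derive_expRN (t : R) : is_derive t (1 : R) (fun s => expR (- s)) (- expR (- t)).
Proof.
have := is_derive_comp_lin (is_derive_expR (-1 * t)).
by under eq_fun do rewrite mulN1r; rewrite !mulN1r.
Qed.

Lemma M2n_ge1 n : (0 < n)%N -> (1%:E <= M2n R n)%E.
Proof.
move=> n0; pose q (t : R) := expR (- t).
have := @M2n_ge_N1 n (expmono 0 (-1)) q (fun t => - q t) (fun t => - - q t) n0.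
rewrite /q oppr0 expR0 opprK normr1; apply.
- by apply: exppoly_mono; rewrite count_nseq /= eqxx mul1n.
- by move=> t; rewrite expmono_N1 expr0 mul1r.
- exact: is_derive_expRN.
- by move=> t; apply: is_deriveN; apply: is_derive_expRN.
- by move=> t t0; rewrite ger0_norm ?expR_ge0 // -expR0 ler_expR oppr_le0.
Qed.

(** The test function is (1 - t/2) e^{-t}, which needs a double exponent. It is bounded by 1 because
    |1 - t/2| <= 1 + t <= e^t, and its second derivative at 0 is 2. *)
Lemma M2n_ge2 n : (1 < n)%N -> (2%:E <= M2n R n)%E.
Proof.
move=> n1; pose e (t : R) := expR (- t).
pose q t : R := (1 - t / 2) * e t.
pose dq t : R := (t / 2 - 3 / 2) * e t.
pose ddq t : R := (2 - t / 2) * e t.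
have De t : is_derive t (1 : R) e (- e t) := is_derive_expRN t.
have Dl (a b t : R) : is_derive t (1 : R) (fun t => a + b * t) b.
  apply: (is_derive_eq (is_deriveD (is_derive_cst a t 1)
    (is_derive_scale b (is_derive_id t 1)))).
  by rewrite add0r mulr1.
have := @M2n_ge_N1 n (fun t => 1 * expmono 0 (-1) t + (- 2^-1)%:C%C * expmono 1 (-1) t)
  q dq ddq (ltnW n1).
have -> : `|ddq 0| = 2.
  by rewrite /ddq /e mul0r subr0 oppr0 expR0 mulr1 ger0_norm.
apply.
- by apply: exppolyD; apply: exppolyZ; apply: exppoly_mono;
    rewrite count_nseq /= eqxx mul1n // ltnW.
- move=> t; rewrite !expmono_N1 expr0 expr1 !mul1r -rmorphM -rmorphD /=.
  by congr (_%:C%C); rewrite /q /e; field.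
- move=> t; rewrite (_ : q = (fun t => 1 + (- 2^-1) * t) * e).
    apply: (is_derive_eq (is_deriveM (Dl _ _ t) (De t))).
    by rewrite !scale_regularE /dq; field.
  by apply/funext => s; rewrite /q /=; congr (_ * _); ring.
- move=> t; rewrite (_ : dq = (fun t => - (3 / 2) + 2^-1 * t) * e).
    apply: (is_derive_eq (is_deriveM (Dl _ _ t) (De t))).
    by rewrite !scale_regularE /ddq; field.
  by apply/funext => s; rewrite /dq /=; congr (_ * _); ring.
- move=> t t0; rewrite /q /e normrM [`|expR _|]ger0_norm ?expR_ge0 //.
  rewrite expRN ler_pdivrMr ?expR_gt0 // mul1r.
  apply: le_trans (expR_ge1Dx t); rewrite ler_norml; apply/andP; split; lra.
Qed.

End ExponentialSums.

(** * Families whose growth rate is below - eps *)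

Section StableFamily.
Variables (R : realType) (n : nat) (fam : set 'M[R]_n) (eps r a C : R).
Hypotheses (eps0 : 0 < eps) (epsr : eps < r) (fam0 : (fam !=set0)%classic).
Hypothesis fam_r : forall A, fam A -> specrad A <= r.
Hypothesis fam_growth : forall A x, switching_traj fam A x ->
  forall t, 0 <= t -> `|x t| <= C * expR (a * t) * `|x 0|.
Hypothesis a_eps : a < - eps.
Local Notation cmx := (map_mx (real_complex R)).

Lemma eigenvalue_le_specrad (A : 'M[R]_n) mu :
  root (char_poly (cmx A)) mu -> normc mu <= specrad A.
Proof.
move=> mu_root; apply: sup_upper_bound; last by exists mu.
split; first by exists (normc mu), mu.
have [s Hs] := closed_field_poly_normal (char_poly (cmx A)).
rewrite (monicP (char_poly_monic _)) scale1r in Hs.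
(* [sup] needs an upper bound: the sum of the moduli of the finitely many roots serves. *)
exists (\sum_(z <- s) normc z) => _ [z /= Hz <-].
have {}Hz : z \in s by rewrite -root_prod_XsubC -Hs.
by rewrite (big_rem z Hz) /= lerDl sumr_ge0 // => i _; apply: normc_ge0.
Qed.

Variable rho : R.
Hypotheses (rho_gt0 : 0 < rho) (rho_sqr : rho ^+ 2 = r ^+ 2 - eps ^+ 2).

(* The eigenvalues [mu] satisfy [|mu| <= r] and [Re mu < - eps], hence
   [|mu + eps|^2 <= r^2 - eps^2]: the shift gains [eps^2]. *)
Lemma scaled_shift_root A z : fam A ->
  root (char_poly (cmx (scaled_shift eps rho A))) z ->
  normc (- z) <= 1 /\ 0 < Re (- z).
Proof.
move=> fA /(root_char_poly_scaled_shift rho_gt0) Hmu.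
have Rmu := eigenvalue_growth fA fam_growth Hmu.
have Nmu := le_trans (eigenvalue_le_specrad Hmu) (fam_r fA).
have {}Nmu : normc (rho%:C%C * z - eps%:C%C) ^+ 2 <= r ^+ 2.
  by rewrite ler_sqr ?nnegrE ?normc_ge0 // ltW // (lt_trans eps0).
move: Rmu Nmu; rewrite normc_sqr; case: z {Hmu} => x y /=.
rewrite !mul0r !subr0 ?addr0 => Rmu Nmu.
split; last first.
  rewrite oppr_gt0 -(pmulr_rlt0 _ rho_gt0); move: a_eps; lra.
rewrite -[leRHS]sqrtr1 ler_sqrt ?ltr01 // !sqrrN.
rewrite -(ler_pM2l (exprn_gt0 2 rho_gt0)) mulr1 mulrDr -!exprMn rho_sqr.
move: a_eps eps0; nra.
Qed.

Definition shifted_flows (Y : 'M[R]_n -> R -> 'M[R]_n) :=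
  [/\ forall A, Y A 0 = 1%:M,
      forall A t, is_mxderive (Y A) t (scaled_shift eps rho A *m Y A t) &
      forall A, exists s : seq R[i], [/\ size s = n,
        forall z, z \in s -> root (char_poly (cmx (scaled_shift eps rho A))) z &
        forall i j, exppoly s (fun t => (Y A t i j)%:C%C)]].

Lemma shifted_flows_exist : exists Y, shifted_flows Y.
Proof.
have /choice[Y HY] : forall A, exists Y : R -> 'M[R]_n,
    [/\ Y 0 = 1%:M, forall t, is_mxderive Y t (scaled_shift eps rho A *m Y t) &
    exists s : seq R[i], [/\ size s = n,
        forall z, z \in s -> root (char_poly (cmx (scaled_shift eps rho A))) z &
        forall i j, exppoly s (fun t => (Y t i j)%:C%C)]].
  move=> A; have [s [Y [H1 H2 H3 H4 H5]]] := flow_exists (scaled_shift eps rho A).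
  by exists Y; split => //; exists s.
by exists Y; split => A; have [] := HY A.
Qed.

Section Flows.
Variable Y : 'M[R]_n -> R -> 'M[R]_n.
Hypothesis HY : shifted_flows Y.
Local Notation F := (flow eps rho Y).
Local Notation B := (scaled_shift eps rho).
Local Notation f := (extremal_norm fam eps rho Y).
(** The growth constant C carries no sign; the maximum with 1 makes it positive, as the extremal
    norm requires. *)
Let C1 := Num.max C 1.

Lemma C1_gt0 : 0 < C1.
Proof. by rewrite lt_max ltr01 orbT. Qed.

(** Trajectories grow at most like e^{aT} with a + eps < 0, which absorbs the discount factor e^{eps
    T}. *)
Lemma reach_growth T Phi : reach fam F T Phi -> forall x : 'cV[R]_n,
  expR (eps * T) * `|Phi *m x| <= C1 * `|x|.
Proof.
have [Y0 dY _] := HY => HT x.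
have T0 := reach_ge0 HT.
have [A [y [[ty _] y0 yT]]] :=
  reach_traj (flow0 eps rho Y0) (dflow rho_gt0 dY) x fam0 HT.
have := fam_growth ty T0; rewrite yT y0.
rewrite -(ler_pM2l (expR_gt0 (eps * T))) => /le_trans; apply.
rewrite mulrA ler_wpM2r // mulrCA -expRD.
apply: (@le_trans _ _ (C1 * expR (eps * T + a * T))).
  by rewrite ler_wpM2r ?expR_ge0 // le_max lexx.
rewrite ler_piMr ?(ltW C1_gt0) // -expR0 ler_expR -mulrDl.
by rewrite mulr_le0_ge0 //; move: a_eps; lra.
Qed.

(** The left-hand side is the second derivative in v of a coordinate of the discounted orbit,
    continued by Phi. *)
Definition second_derivative_bound K := forall A x T Phi i v, fam A ->
  reach fam F T Phi -> 0 <= v ->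
  `|expR (eps * T) * (Phi *m (B A *m (B A *m Y A v) *m x)) i ord0| <= K * f x.

(** Each coordinate is an exponential polynomial in the eigenvalues of B, whose negatives form a
    point of D_n, and it is bounded by the extremal norm of x. *)
Lemma second_derivative_bound_M2n M : M2n R n = M%:E ->
  second_derivative_bound M.
Proof.
have [Y0 dY Ys] := HY => EM A x T Phi i v fA HT v0.
(* [M2n_bound] divides by the extremal norm, so x = 0 is separate; there 0 <= M suffices, and the
   index i shows n > 0. *)
have [->|x0] := eqVneq x 0.
  rewrite !mulmx0 mxE mulr0 normr0 mulr_ge0 //; last first.
    exact: (extremal_norm_ge0 reach_growth).
  rewrite -lee_fin -EM; apply: le_trans (M2n_ge1 R _); first by rewrite lee_fin ler01.
  by case: (n) i => // -[].
have f0 : 0 < f x.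
  by apply: lt_le_trans (norm_le_extremal reach_growth x); rewrite normr_gt0.
have [s [szs rs Ps]] := Ys A.
pose q v := expR (eps * T) * (Phi *m (Y A v *m x)) i ord0.
have Hq : exppoly s (fun v => (q v)%:C%C).
  have Hk k : exppoly s (fun v => \sum_l (x l ord0)%:C%C * (Y A v k l)%:C%C).
    exact: exppoly_sum.
  have := exppolyZ (expR (eps * T))%:C%C
    (exppoly_sum (index_enum 'I_n) (fun k => (Phi i k)%:C%C) Hk).
  move/exppoly_ext; apply => w.
  rewrite /q mxE rmorphM rmorph_sum /=; congr (_ * _); apply: eq_bigr => k _.
  rewrite mxE rmorphM rmorph_sum /=; congr (_ * _); apply: eq_bigr => l _.
  by rewrite rmorphM /= mulrC.
have [c Ec] := exppoly_Ph szs Hq.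
apply: (M2n_bound (h := fun k : 'I_n => - s`_k) (c := c) (q := q)
  (dq := fun v => expR (eps * T) * (Phi *m (B A *m Y A v *m x)) i ord0)
  (ddq := fun v => expR (eps * T) *
    (Phi *m (B A *m (B A *m Y A v) *m x)) i ord0) _ _ _ _ f0 _ EM v0).
- move=> k; apply: scaled_shift_root fA _; apply: rs.
  by rewrite mem_nth // szs.
- by move=> t; rewrite -Ec.
- move=> t; apply: is_derive_scale.
  exact: (is_mxderive_mull Phi (is_mxderive_mulr x (dY _ _)) i ord0).
- move=> t; apply: is_derive_scale.
  exact: (is_mxderive_mull Phi (is_mxderive_mulr x
    (is_mxderive_mull (B A) (dY _ _))) i ord0).
- move=> t t0; rewrite normrM [`|expR _|]ger0_norm ?expR_ge0 //.
  apply: le_trans (reach_flow_bound rho_gt0 reach_growth x HT fA t0).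
  by rewrite ler_wpM2l ?expR_ge0 // mx_entry_le.
Qed.

(** A crude bound independent of M_{2,n}: Phi costs C1, and each of the two factors B costs n b,
    with b bounding the norm of B over the compact family. *)
Lemma second_derivative_bound_compact : compact fam ->
  exists2 K, 0 <= K & second_derivative_bound K.
Proof.
have [Y0 dY Ys] := HY.
move=> /compact_bounded[N [_ HN]].
pose b := rho^-1 * ((`|N| + 1) + `|eps%:M : 'M[R]_n|).
have b0 : 0 <= b by rewrite mulr_ge0 ?invr_ge0 ?(ltW rho_gt0) // !addr_ge0.
have Bb A : fam A -> `|B A| <= b.
  move=> fA; rewrite mx_normZ ger0_norm ?invr_ge0 ?(ltW rho_gt0) //.
  rewrite ler_wpM2l ?invr_ge0 ?(ltW rho_gt0) //.
  apply: le_trans (ler_normD _ _) _; rewrite lerD2r.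
  by apply: HN => //; rewrite (le_lt_trans (ler_norm N)) // ltrDl.
have nb0 : 0 <= n%:R * b by rewrite mulr_ge0.
exists (C1 * ((n%:R * b) * (n%:R * b))).
  by apply: mulr_ge0; [exact: ltW C1_gt0|exact: mulr_ge0].
move=> A x T Phi i v fA HT v0.
have HB (y : 'cV[R]_n) : `|B A *m y| <= n%:R * b * `|y|.
  apply: le_trans (mulmx_norm_le _ _) _; rewrite ler_wpM2r //.
  by rewrite ler_wpM2l // Bb.
have Yx : `|Y A v *m x| <= f x.
  have := reach_flow_bound rho_gt0 reach_growth x (reach0 fam F) fA v0.
  by rewrite mulr0 expR0 !mul1mx mul1r.
rewrite normrM [`|expR _|]ger0_norm ?expR_ge0 //.
apply: (@le_trans _ _ (expR (eps * T) * `|Phi *m (B A *m (B A *m (Y A v *m x)))|)).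
  by rewrite ler_wpM2l ?expR_ge0 // -!mulmxA mx_entry_le.
apply: le_trans (reach_growth HT _) _.
rewrite -[X in _ <= X]mulrA ler_wpM2l ?(ltW C1_gt0) //.
apply: le_trans (HB _) _; rewrite -[X in _ <= X]mulrA ler_wpM2l //.
by apply: le_trans (HB _) _; rewrite ler_wpM2l.
Qed.

Lemma jsr_lt1_of_bound K tau : 0 <= K -> second_derivative_bound K -> 0 < tau ->
  tau * (rho ^+ 2 * K + 2 * eps ^+ 2) < 2 * eps ->
  jsr [set 1%:M + tau *: M | M in fam]%classic < 1.
Proof.
have [Y0 dY _] := HY => K0 HK tau0 Htau.
apply: (jsr_euler_lt1 eps0 rho_gt0 Y0 dY C1_gt0 reach_growth fam0 K0 tau0 Htau).
exact: HK.
Qed.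

End Flows.

(** It rules out an empty set of admissible steps, whose supremum would be minus infinity. *)
Lemma exists_stable_step : compact fam ->
  exists2 tau, 0 < tau & jsr [set 1%:M + tau *: M | M in fam]%classic < 1.
Proof.
move=> cfam; have [Y HY] := shifted_flows_exist.
have [K K0 HK] := second_derivative_bound_compact HY cfam.
pose D := rho ^+ 2 * K + 2 * eps ^+ 2.
have D0 : 0 < D.
  by apply: ltr_wpDl; [rewrite mulr_ge0 // sqr_ge0|rewrite mulr_gt0 // exprn_gt0].
exists (eps / D); first by rewrite divr_gt0.
apply: (jsr_lt1_of_bound HY K0 HK); first by rewrite divr_gt0.
by rewrite -/D divfK ?gt_eqF // ltr_pMl // ltr1n.
Qed.

(** With rho^2 = r^2 - eps^2, rho^2 M + 2 eps^2 = r^2 M - eps^2 (M - 2), which is at most r^2 M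
    because M >= 2. *)
Lemma stable_step M tau : (1 < n)%N -> M2n R n = M%:E -> 0 < tau ->
  tau < 2 * eps / r ^+ 2 / M ->
  jsr [set 1%:M + tau *: M | M in fam]%classic < 1.
Proof.
move=> n1 EM tau0; have [Y HY] := shifted_flows_exist.
have M2 : 2 <= M by rewrite -lee_fin -EM M2n_ge2.
have r0 : 0 < r by exact: lt_trans epsr.
have M0 : 0 < M by lra.
rewrite ltr_pdivlMr // ltr_pdivlMr ?exprn_gt0 // => Htau.
apply: (jsr_lt1_of_bound HY (ltW M0) (second_derivative_bound_M2n HY EM) tau0).
apply: le_lt_trans Htau; rewrite -mulrA ler_wpM2l ?(ltW tau0) // rho_sqr.
have : 0 <= eps ^+ 2 * (M - 2) by rewrite mulr_ge0 ?sqr_ge0 // subr_ge0.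
nra.
Qed.

End StableFamily.

(** * Dimension one *)

Section Scalar.
Variable R : realType.

(** The single entry is an eigenvalue lying in [- r, - eps), so 1 + tau A lies in [1 - tau r, 1 -
    eps tau); both ends have modulus below 1 once tau r < 2. *)
Lemma stable_step_dim1 (fam : set 'M[R]_1) (eps r a C tau : R) :
  0 < eps -> eps < r -> (fam !=set0)%classic ->
  (forall A, fam A -> specrad A <= r) ->
  (forall A x, switching_traj fam A x ->
    forall t, 0 <= t -> `|x t| <= C * expR (a * t) * `|x 0|) ->
  a < - eps -> 0 < tau -> tau < 2 * eps / r ^+ 2 ->
  jsr [set 1%:M + tau *: M | M in fam]%classic < 1.
Proof.
move=> eps0 epsr fam0 fam_r HC aeps tau0.
have r0 : 0 < r by exact: lt_trans epsr.
rewrite ltr_pdivlMr ?exprn_gt0 // => Htau.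
(* This follows from tau r^2 < 2 eps < 2 r. *)
have tau_r : tau * r < 2.
  have : tau * r * r < 2 * r.
    by rewrite -mulrA -expr2; apply: lt_trans Htau _; rewrite ltr_pM2l.
  by rewrite ltr_pM2r.
pose lam := Num.max (1 - eps * tau) (tau * r - 1).
have Hlam A : fam A -> `|1 + tau * A 0 0| <= lam.
  move=> fA.
  have rt : root (char_poly (map_mx (real_complex R) A)) (A 0 0)%:C%C.
    rewrite -eigenvalue_root_char; apply/eigenvalueP; exists 1%:M.
      rewrite mul1mx {1}[A]mx11_scalar map_scalar_mx /=.
      by rewrite scale_scalar_mx mulr1.
    by apply/eqP => /matrixP/(_ 0 0); rewrite !mxE => /eqP; rewrite oner_eq0.
  have /= Ha := eigenvalue_growth fA HC rt.
  have := le_trans (eigenvalue_le_specrad rt) (fam_r _ fA).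
  rewrite normc_real_complex ler_norml => /andP[ra _].
  rewrite ler_norml /lam lerNl !le_max; apply/andP; split; apply/orP.
    by right; rewrite opprD addrC lerD2r -mulrN ler_pM2l // lerNl.
  by left; rewrite lerD2l mulrC -mulNr ler_wpM2r ?(ltW tau0) //; lra.
have M11 (A : 'M[R]_1) (x : 'cV[R]_1) :
    `|(1%:M + tau *: A) *m x| = `|1 + tau * A 0 0| * `|x|.
  rewrite {1}[A]mx11_scalar scale_scalar_mx -raddfD /= mul_scalar_mx.
  exact: mx_normZ.
apply: (@jsr_lt1 R 1 _ (fun x => `|x|) 1 lam) => //.
- by case: fam0 => M fM; exists (1%:M + tau *: M), M.
- by case: fam0 => M /Hlam; apply: le_trans.
- by rewrite /lam gt_max; apply/andP; split; nra.
- by move=> x; rewrite mul1r.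
- by move=> _ x [A fA <-]; rewrite M11 ler_wpM2r // Hlam.
Qed.

End Scalar.

(** * The lower bound for S_r *)

Theorem theorem5 (R : realType) (n : nat) : (0 < n)%N ->
  forall eps r : R, 0 < eps -> eps < r ->
  ((2 * eps / r ^+ 2)%:E * (M2n R n)^-1 <= S_r n eps r)%E.
Proof.
move=> n0 eps r eps0 epsr.
have r0 : 0 < r by exact: lt_trans epsr.
have b0 : 0 < 2 * eps / r ^+ 2 by rewrite divr_gt0 ?mulr_gt0 ?exprn_gt0.
apply: le_ereal_inf_tmp => _ [fam [cfam fam0 fam_r] <-].
rewrite /S_fam; case: ifPn => [_|]; first exact: leey.
rewrite -ltNge => /ereal_inf_lt[_ [a [C HC] <-]]; rewrite lte_fin => aeps.
set S := ereal_sup _.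
have HS tau : 0 < tau -> jsr [set 1%:M + tau *: M | M in fam]%classic < 1 ->
  (tau%:E <= S)%E by move=> *; apply: ereal_sup_ubound; exists tau.
have rho20 : 0 < r ^+ 2 - eps ^+ 2.
  by rewrite subr_gt0 ltr_sqr ?nnegrE // ltW.
have rho0 : 0 < Num.sqrt (r ^+ 2 - eps ^+ 2) by rewrite sqrtr_gt0.
have rho2 := sqr_sqrtr (ltW rho20).
have S0 : (0 <= S)%E.
  have [tau tau0 Htau] := exists_stable_step eps0 fam0 HC aeps rho0 cfam.
  by apply: le_trans (HS _ tau0 Htau); rewrite lee_fin ltW.
have M1 := M2n_ge1 R n0.
(* If M_{2,n} is infinite, its inverse is 0 and the claim reduces to [S0]. *)
case EM : (M2n R n) M1 => [M| |] //; last by rewrite invey mule0.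
rewrite lee_fin => M1; have M0 : 0 < M by exact: lt_le_trans M1.
rewrite inver gt_eqF // -EFinM.
set b := _ / M; have bM0 : 0 < b by rewrite divr_gt0.
apply/lee_addgt0Pr => e e0.
(* The strict inequality tau < b excludes b itself, so b is approached within e from below; b / 2
   keeps tau positive. *)
pose tau := Num.max (b / 2) (b - e).
have tau0 : 0 < tau by rewrite lt_max divr_gt0.
have taub : tau < b by rewrite gt_max; apply/andP; split; lra.
have Htau : jsr [set 1%:M + tau *: M | M in fam]%classic < 1.
  have [n1|] := ltnP 1 n.
    exact: (stable_step eps0 epsr fam0 fam_r HC aeps rho0 rho2 n1 EM tau0 taub).
  move=> n1; have {n1} En : n = 1%N by apply/eqP; rewrite eqn_leq n1 n0.
  subst n; apply: (stable_step_dim1 eps0 epsr fam0 fam_r HC aeps tau0).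
  (* In dimension one M >= 1 gives b <= 2 eps / r^2. *)
  by apply: lt_le_trans taub _; rewrite ler_pdivrMr // ler_peMr // ltW.
apply: le_trans (leeD2r _ (HS _ tau0 Htau)).
by rewrite -EFinD lee_fin -lerBlDr le_max lexx orbT.
Qed.
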